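(* Let $n\ge 2$ and $0\le\alpha<\beta\le\infty$. To each admissible pair $(\mathscr F,\mathcal C)$ on the annulus $\mathcal A_{\alpha,\beta}\subset(\mathbb C^n,J_0)$ there exists a unique associated $\mathrm{U}(n)$-invariant non-Kähler Hermitian Klsc metric, given by $$g_{(\mathscr F,\mathcal C)}=\Bigg((\mathbf z\mathscr F)'-\frac{2}{\mathbf z^{n-1}\mathscr F^{n-2}}\Big(\int\frac{1}{\mathbf z^n\mathscr F^{n-1}}\,d\mathbf z+(2n-1)\,\mathcal C\Big)^{-1}\Bigg)\Big((d\sqrt{\mathbf z})^2+\mathbf z\, h\Big)+(\mathbf z\mathscr F)\, g_{\mathbb{CP}^{n-1}}.$$ Moreover, the moduli space of $\mathrm{U}(n)$-invariant non-Kähler Hermitian Klsc metrics on $(\mathcal A_{\alpha,\beta},J_0)$ (i.e. the set of all such metrics) is given by all the metrics $g_{(\mathscr F,\mathcal C)}$ as $(\mathscr F,\mathcal C)$ ranges over all admissible pairs on $\mathcal A_{\alpha,\beta}$.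
   Context: $J_0$ is the standard complex structure on $\mathbb C^n$, $\mathbf z=\sum_{i=1}^n|z_i|^2$, and $\mathcal A_{\alpha,\beta}=\{(z_1,\dots,z_n)\in\mathbb C^n: \alpha<\mathbf z<\beta\}$ (the origin is excluded). Primes denote derivatives with respect to $\mathbf z$. The round metric on the unit sphere $S^{2n-1}$ decomposes as $g_{S^{2n-1}}=g_{\mathbb{CP}^{n-1}}+h$, where $g_{\mathbb{CP}^{n-1}}$ is (the pullback under the Hopf fibration of) the Fubini–Study metric on $\mathbb{CP}^{n-1}$ and $h$ is the metric along the Hopf fiber; thus the Euclidean metric is $(d\sqrt{\mathbf z})^2+\mathbf z h+\mathbf z g_{\mathbb{CP}^{n-1}}$. Any $\mathrm{U}(n)$-invariant Hermitian metric on $(\mathcal A_{\alpha,\beta},J_0)$ has the form $\mathscr E(\mathbf z)\big((d\sqrt{\mathbf z})^2+\mathbf z h\big)+\mathbf z\mathscr F(\mathbf z)\,g_{\mathbb{CP}^{n-1}}$ with $\mathscr E,\mathscr F$ smooth positive functions of $\mathbf z$. Admissibility: for each smooth positive function $\mathscr F(\mathbf z)$ on $\mathcal A_{\alpha,\beta}$ an antiderivative $\int\frac{1}{\mathbf z^n\mathscr F^{n-1}}d\mathbf z$ is fixed once and for all (the same one is used in every formula). For a real constant $\mathcal C$, the pair $(\mathscr F,\mathcal C)$ is admissible on $\mathcal A_{\alpha,\beta}$ if the function $$\mathbf z\mathscr F\cdot\Big(\frac{1}{2n-1}\int\frac{1}{\mathbf z^n\mathscr F^{n-1}}\,d\mathbf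 z+\mathcal C\Big)^{-2}$$ is defined and strictly increasing on $\mathcal A_{\alpha,\beta}$, in the sense that its derivative with respect to $\mathbf z$ is everywhere positive. Klsc: for a Hermitian metric $g$ on a complex manifold, $S$ is the Riemannian scalar curvature (of the Levi-Civita connection) and $S_C=g^{i\bar j}\Theta_{i\bar j}$ is the Chern scalar curvature, where $g_{i\bar j}=g(\partial_{z_i},\partial_{\bar z_j})$ and $\sqrt{-1}\,\Theta_{i\bar j}\,dz_i\wedge d\bar z_j=-\sqrt{-1}\,\partial\bar\partial\log\det(g_{i\bar j})$. A Hermitian metric is a Kähler like scalar curvature (Klsc) metric if $S=2S_C$. It is Kähler if $\omega(\cdot,\cdot)=g(J\cdot,\cdot)$ is closed. *)

(* Defs.v *)
From HB Require Import structures.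
From mathcomp Require Import all_boot all_order all_algebra.
From mathcomp Require Import complex.
From mathcomp Require Import all_classical all_reals all_analysis.
Set Implicit Arguments.
Unset Strict Implicit.
Unset Printing Implicit Defensive.
Import Order.TTheory GRing.Theory Num.Theory.
Import numFieldNormedType.Exports.
Local Open Scope classical_set_scope.
Local Open Scope complex_scope.
Local Open Scope ring_scope.

(* C^n is modelled on its underlying real vector space 'rV[R]_(n + n): the    *)
(* row vector row_mx x y stands for z = x + i y.  Tensor fields are total     *)
(* functions on 'rV[R]_(n + n) of which only the values on the open set under *)
(* consideration are meaningful.                                              *)

Section Smooth.
Context {R : realType} {V W : normedModType R}.

Fixpoint Ck_on (k : nat) (U : set V) (f : V -> W) : Prop :=
  if k is k'.+1 then
    (forall x v, U x -> derivable f x v) /\ (forall v, Ck_on k' U ('D_v f))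
  else forall x, U x -> {for x, continuous f}.

(* Intended for open U. *)
Definition smooth_on (U : set V) (f : V -> W) : Prop :=
  forall k, Ck_on k U f.

End Smooth.

Section Riemannian.
Context {R : realType} {m : nat}.
Implicit Types (U : set 'rV[R]_m) (g : 'rV[R]_m -> 'M[R]_m) (p u v : 'rV[R]_m).

Definition inner g p u v : R := (u *m g p *m v^T) 0 0.

Definition riemannian_metric U g : Prop :=
  [/\ forall i j, smooth_on U (fun p => g p i j),
      forall p, U p -> (g p)^T = g p
    & forall p v, U p -> v != 0 -> 0 < inner g p v v].

Definition std_basis (k : 'I_m) : 'rV[R]_m := delta_mx 0 k.

Definition pd (k : 'I_m) (f : 'rV[R]_m -> R) (p : 'rV[R]_m) : R :=
  'D_(std_basis k) f p.

(* Gamma^i_(jk) *)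
Definition christoffel g (i j k : 'I_m) p : R :=
  2^-1 * \sum_l invmx (g p) i l *
    (pd j (fun q => g q l k) p + pd k (fun q => g q l j) p
     - pd l (fun q => g q j k) p).

(* The component along d_l of R(d_i, d_j) d_k, where                          *)
(* R(X, Y) Z = nabla_X nabla_Y Z - nabla_Y nabla_X Z - nabla_[X, Y] Z.        *)
Definition riemann g (l i j k : 'I_m) p : R :=
  pd i (christoffel g l j k) p - pd j (christoffel g l i k) p
  + \sum_s (christoffel g l i s p * christoffel g s j k p
            - christoffel g l j s p * christoffel g s i k p).

Definition ricci g (j k : 'I_m) p : R := \sum_i riemann g i i j k p.

Definition scalar_curvature g p : R :=
  \sum_j \sum_k invmx (g p) j k * ricci g j k p.

End Riemannian.

Section Hermitian.
Context {R : realType} {n : nat}.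
Implicit Types (U : set 'rV[R]_(n + n)) (p u v w : 'rV[R]_(n + n)).
Implicit Types (g : 'rV[R]_(n + n) -> 'M[R]_(n + n)) (i j : 'I_n).

Definition J0 v : 'rV[R]_(n + n) := row_mx (- rsubmx v) (lsubmx v).

Definition hermitian_metric U g : Prop :=
  riemannian_metric U g /\
  forall p u v, U p -> inner g p (J0 u) (J0 v) = inner g p u v.

Definition toC v : 'rV[R[i]]_n := \row_i (lsubmx v 0 i +i* rsubmx v 0 i).

Definition ofC (z : 'rV[R[i]]_n) : 'rV[R]_(n + n) :=
  row_mx (map_mx (@complex.Re R) z) (map_mx (@complex.Im R) z).

(* z |-> A z for the column vector z; vectors are rows here, hence A^T. *)
Definition cact (A : 'M[R[i]]_n) v : 'rV[R]_(n + n) := ofC (toC v *m A^T).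

(* Intended for U stable under U(n). *)
Definition Un_invariant U g : Prop :=
  forall A : 'M[R[i]]_n, A \is unitarymx -> forall p u v, U p ->
    inner g (cact A p) (cact A u) (cact A v) = inner g p u v.

Definition kahler_form g p u v : R := inner g p (J0 u) v.

(* (d omega)(u, v, w) = 0 for all constant vector fields u, v, w *)
Definition kahler U g : Prop :=
  forall p u v w, U p ->
    'D_u (fun q => kahler_form g q v w) p
    + 'D_v (fun q => kahler_form g q w u) p
    + 'D_w (fun q => kahler_form g q u v) p = 0.

Definition e_x i : 'rV[R]_(n + n) := std_basis (lshift n i).
Definition e_y i : 'rV[R]_(n + n) := std_basis (rshift n i).

(* d/dz_i and d/dzbar_i, as operators on complex-valued functions and as      *)
(* complexified tangent vectors *)

Definition dC v (f : 'rV[R]_(n + n) -> R[i]) p : R[i] :=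
  'D_v (fun q => complex.Re (f q)) p
  +i* 'D_v (fun q => complex.Im (f q)) p.

Definition dz i (f : 'rV[R]_(n + n) -> R[i]) p : R[i] :=
  2^-1 * (dC (e_x i) f p - 'i * dC (e_y i) f p).

Definition dzbar i (f : 'rV[R]_(n + n) -> R[i]) p : R[i] :=
  2^-1 * (dC (e_x i) f p + 'i * dC (e_y i) f p).

Definition vz i : 'rV[R[i]]_(n + n) :=
  2^-1 *: (map_mx (real_complex R) (e_x i)
           - 'i *: map_mx (real_complex R) (e_y i)).

Definition vzbar i : 'rV[R[i]]_(n + n) :=
  2^-1 *: (map_mx (real_complex R) (e_x i)
           + 'i *: map_mx (real_complex R) (e_y i)).

(* g_{i jbar}, through the complex bilinear extension of g *)
Definition herm_mx g p : 'M[R[i]]_n :=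
  \matrix_(i, j) (vz i *m map_mx (real_complex R) (g p) *m (vzbar j)^T) 0 0.

(* \det (g_{i jbar}) is a positive real number, hence the use of the real     *)
(* logarithm of its real part. *)
Definition chern_form g i j p : R[i] :=
  - dz i (dzbar j (fun q => (ln (complex.Re (\det (herm_mx g q))))%:C)) p.

(* g^{i jbar} is defined by \sum_j g^{i jbar} g_{k jbar} = delta_ik: it is    *)
(* the (j, i) entry of the inverse matrix. *)
Definition chern_scalar_curvature g p : R[i] :=
  \sum_i \sum_j invmx (herm_mx g p) j i * chern_form g i j p.

Definition klsc U g : Prop :=
  forall p, U p -> (scalar_curvature g p)%:C = 2 * chern_scalar_curvature g p.

Definition Un_nonkahler_klsc U g : Prop :=
  [/\ hermitian_metric U g, Un_invariant U g, klsc U g & ~ kahler U g].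

Definition zsq p : R := \sum_(i < n) (lsubmx p 0 i ^+ 2 + rsubmx p 0 i ^+ 2).

Definition annulus (alpha : R) (beta : \bar R) : set 'rV[R]_(n + n) :=
  [set p | (alpha%:E < (zsq p)%:E < beta)%E].

Definition d_sqrt_zsq p u : R := 'D_u (fun q => Num.sqrt (zsq q)) p.

(* At a point of the unit sphere the Hopf fibre is spanned by the unit vector *)
(* J0 p; h is extended to C^n \ {0} by pulling back along p |-> p / |p|.      *)
Definition hopf_coform p u : R := (J0 p *m u^T) 0 0 / zsq p.

Definition h_fiber p u v : R := hopf_coform p u * hopf_coform p v.

(* The Fubini-Study metric in homogeneous coordinates, normalized so that     *)
(* the Hopf fibration is a Riemannian submersion from the unit sphere, i.e.,  *)
(* so that E = F = 1 gives the Euclidean metric in Un_metric below. *)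
Definition fubini_study p u v : R :=
  complex.Re ((zsq p)%:C * dotmx (toC u) (toC v)
              - dotmx (toC u) (toC p) * dotmx (toC p) (toC v)) / zsq p ^+ 2.

(* E(z) ((d sqrt z)^2 + z h) + z F(z) g_CP *)
Definition Un_metric (E F : R -> R) p : 'M[R]_(n + n) :=
  \matrix_(a, b)
    (E (zsq p) * (d_sqrt_zsq p (std_basis a) * d_sqrt_zsq p (std_basis b)
                  + zsq p * h_fiber p (std_basis a) (std_basis b))
     + zsq p * F (zsq p) * fubini_study p (std_basis a) (std_basis b)).

End Hermitian.

Section Admissible.
Context {R : realType}.
Implicit Types (n : nat) (alpha C t : R) (beta : \bar R) (F : R -> R).
Implicit Types (Prim : (R -> R) -> R -> R).

Definition radii alpha beta : set R := [set t | (alpha%:E < t%:E < beta)%E].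

Definition smooth_positive alpha beta F : Prop :=
  smooth_on (radii alpha beta) (F) /\
  forall t, radii alpha beta t -> 0 < F t.

(* Prim F is the antiderivative of 1 / (z^n F^(n-1)) that is fixed once and    *)
(* for all; it depends on F only as a function on the annulus. *)
Definition antiderivative_choice n alpha beta Prim : Prop :=
  (forall F, smooth_positive alpha beta F -> forall t, radii alpha beta t ->
     is_derive t 1 (Prim F) (t ^+ n * F t ^+ (n - 1))^-1) /\
  (forall F1 F2, (forall t, radii alpha beta t -> F1 t = F2 t) ->
     forall t, radii alpha beta t -> Prim F1 t = Prim F2 t).

Definition admissible n alpha beta Prim F C : Prop :=
  let G t := (2 * n%:R - 1)^-1 * Prim F t + C in
  [/\ smooth_positive alpha beta F,
      forall t, radii alpha beta t -> G t != 0
    & forall t, radii alpha beta t ->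
        0 < derive1 (fun s : R => s * F s * G s ^- 2) t].

Definition g_pair n Prim F C : 'rV[R]_(n + n) -> 'M[R]_(n + n) :=
  Un_metric
    (fun t => derive1 (fun s : R => s * F s) t
       - 2 / (t ^+ (n - 1) * F t ^+ (n - 2))
         * (Prim F t + (2 * n%:R - 1) * C)^-1)
    F.

End Admissible.

(* Main.v *)
Require Import Defs.
From HB Require Import structures.
From mathcomp Require Import all_boot all_order all_algebra.
From mathcomp Require Import complex.
From mathcomp Require Import all_classical all_reals all_analysis.
From mathcomp Require Import ring lra.
Set Implicit Arguments.
Unset Strict Implicit.
Unset Printing Implicit Defensive.
Import Order.TTheory GRing.Theory Num.Theory.
Import numFieldNormedType.Exports.
Local Open Scope ring_scope.

(** Let [z = |p|^2] and let primes denote derivatives in [z].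

    Sign changes and exchanges of coordinates are unitary, and they diagonalise
    a U(n)-invariant Hermitian metric along one ray; U(n) is transitive on
    spheres, so the metric is [Un_metric E F] for two positive functions
    ([Un_invariant_normal_form]). In matrix form it is
    [F I + b (p^T p + (J0 p)^T (J0 p))] with [b = (E - F) / z], a rank-two
    perturbation of a multiple of the identity, and this makes the inverse
    matrix, the Christoffel symbols and the determinant explicit. The exterior
    derivative of the Kaehler form is a multiple of the torsion [s = F' - b], so
    the metric is Kaehler iff [s] vanishes identically ([kahler_rot]).

    For the scalar curvature [S], let [V^i = g^(jk) Gamma^i_(jk)] and
    [W_k = Gamma^i_(ik)] be the traces of the Christoffel symbols. Since the
    metric is parallel, [S] is the divergence of [V], minus [g^(jk) d_j W_k],
    plus [W_s V^s], minus half of [d_s g^(ik) Gamma^s_(ik)]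
    ([scalar_curvature_divergence]). Now [W] is half the gradient of
    [log det g], and for the metrics at hand the term in its derivative is
    exactly [2 S_C]. In [S - 2 S_C] the second derivatives of [E] therefore
    cancel; moreover [V] is proportional to [s p], and what remains is the
    first-order equation
    [n s + z s' + (n - 2) z s F' / F + z s^2 / (2 F) = 0] ([klsc_ode]).

    The function [y = z^n F^(n-2) s] turns it into the Riccati equation
    [y' = - y^2 / (2 z^n F^(n-1))] ([klsc_riccati]). Its solutions vanish
    identically, which is the Kaehler case, or nowhere; in the second case
    [2 / y] is an antiderivative of [1 / (z^n F^(n-1))] ([riccati_solution]).
    Solving [y = 2 / (Prim F + (2 n - 1) C)] for [E] gives the formula for
    [g_pair] ([torsion_pair]). Finally, with
    [G = Prim F / (2 n - 1) + C], the derivative of [z F G^(-2)] is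
    [E G^(-2)], so admissibility of the pair means that [E] is positive
    ([admissible_derive]). *)

(** * Directional derivatives *)

Section DirectionalDerivatives.
Context {R : realType} {V : normedModType R}.
Implicit Types (f g : V -> R) (p v : V).

Lemma is_derive_add f g p v (df dg : R) :
  is_derive p v f df -> is_derive p v g dg ->
  is_derive p v (fun q => f q + g q) (df + dg).
Proof. exact: is_deriveD. Qed.

Lemma is_derive_sub f g p v (df dg : R) :
  is_derive p v f df -> is_derive p v g dg ->
  is_derive p v (fun q => f q - g q) (df - dg).
Proof. exact: is_deriveB. Qed.

Lemma is_derive_opp f p v (df : R) :
  is_derive p v f df -> is_derive p v (fun q => - f q) (- df).
Proof. exact: is_deriveN. Qed.

Lemma is_derive_mul f g p v (df dg : R) :
  is_derive p v f df -> is_derive p v g dg ->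
  is_derive p v (fun q => f q * g q) (df * g p + f p * dg).
Proof.
move=> hf hg; apply: (is_derive_eq (is_deriveM hf hg)).
by rewrite addrC [df * _]mulrC.
Qed.

Lemma is_derive_inv f p v (df : R) : f p != 0 ->
  is_derive p v f df -> is_derive p v (fun q => (f q)^-1) (- (f p) ^- 2 * df).
Proof.
move=> f0 [hf <-]; split; first exact: derivableV.
exact: deriveV.
Qed.

Lemma is_derive_const (c : R) p v : is_derive p v (fun _ => c) 0.
Proof. exact: is_derive_cst. Qed.

Lemma is_derive_exp f p v (df : R) k : is_derive p v f df ->
  is_derive p v (fun q => f q ^+ k) (k%:R * f p ^+ k.-1 * df).
Proof.
move=> hf; elim: k => [|k IH].
  by apply: (is_derive_eq (is_derive_const 1 p v)); rewrite !mul0r.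
rewrite (_ : (fun q => _) = fun q => f q * f q ^+ k); last first.
  by apply/funext => q; rewrite exprS.
apply: (is_derive_eq (is_derive_mul hf IH)); rewrite /= -natr1.
by case: k {IH} => [|k] /=; rewrite ?expr0 ?exprS; ring.
Qed.

Lemma is_derive_sums m (f : 'I_m -> V -> R) p v (df : 'I_m -> R) :
  (forall i, is_derive p v (f i) (df i)) ->
  is_derive p v (fun q => \sum_i f i q) (\sum_i df i).
Proof.
move=> h; have -> : (fun q => \sum_i f i q) = \sum_i f i.
  by apply/funext => q; rewrite fct_sumE.
exact: is_derive_sum.
Qed.

(** Restricting [f] to the line through [p] along [v] turns a directional
    derivative into a derivative of a function of one variable, where the
    one-variable chain rule applies. *)
Lemma is_derive_line {W : normedModType R} (f : V -> W) p v (df : W) :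
  is_derive p v f df <-> is_derive (0 : R) 1 (fun h => f (h *: v + p)) df.
Proof.
have E : 'D_v f p = 'D_1 (fun h : R => f (h *: v + p)) 0.
  rewrite /derive; set f1 := fun h => h^-1 *: _; set f2 := fun h => h^-1 *: _.
  suff -> : f1 = f2 by [].
  by apply/funext => h; rewrite /f1 /f2 /= addr0 scale0r add0r [_%:A]mulr1.
split=> -[h1 h2]; split.
- exact: (proj1 (derivable1P f p v) h1).
- by rewrite -E.
- exact: (proj2 (derivable1P f p v) h1).
- by rewrite E.
Qed.

Lemma is_derive_compose (phi : R -> R) f p v (df dphi : R) :
  is_derive (f p) 1 phi dphi -> is_derive p v f df ->
  is_derive p v (fun q => phi (f q)) (dphi * df).
Proof.
move=> hphi /is_derive_line hf; apply/is_derive_line.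
by apply: is_derive1_comp => //; rewrite scale0r add0r.
Qed.

Lemma derivable_const (c : R) p v : derivable (fun=> c) p v.
Proof. exact: derivable_cst. Qed.

Lemma derivable_add f g p v :
  derivable f p v -> derivable g p v -> derivable (fun q => f q + g q) p v.
Proof. exact: derivableD. Qed.

Lemma derivable_opp f p v : derivable f p v -> derivable (fun q => - f q) p v.
Proof. exact: derivableN. Qed.

Lemma derivable_mul f g p v :
  derivable f p v -> derivable g p v -> derivable (fun q => f q * g q) p v.
Proof. exact: derivableM. Qed.

Lemma derivable_exp f p v k :
  derivable f p v -> derivable (fun q => f q ^+ k) p v.
Proof.
move=> df; elim: k => [|k IH]; first exact: derivable_cst.
rewrite (_ : (fun q => _) = fun q => f q * f q ^+ k); first exact: derivable_mul.
by apply/funext => q; rewrite exprS.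
Qed.

Lemma derivable_inv f p v :
  f p != 0 -> derivable f p v -> derivable (fun q => (f q)^-1) p v.
Proof. by move=> f0 df; apply: derivableV. Qed.

Lemma derivable_sums m (f : 'I_m -> V -> R) p v :
  (forall i, derivable (f i) p v) -> derivable (fun q => \sum_i f i q) p v.
Proof. by move=> df; have [] := is_derive_sums (fun i => derivableP (df i)). Qed.

End DirectionalDerivatives.

(** Reduces the derivability of an algebraic expression to that of its leaves.
    It follows the syntax alone, since unifying large terms is costly. *)
Ltac derivable_expr := repeat lazymatch goal with
  | |- derivable (fun _ => ?c) ?p ?v => exact (@derivable_const _ _ c p v)
  | |- derivable (fun q => GRing.add (@?a q) (@?b q)) ?p ?v =>
      refine (@derivable_add _ _ a b p v _ _)
  | |- derivable (fun q => GRing.opp (@?a q)) ?p ?v =>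
      refine (@derivable_opp _ _ a p v _)
  | |- derivable (fun q => GRing.mul (@?a q) (@?b q)) ?p ?v =>
      refine (@derivable_mul _ _ a b p v _ _)
  | |- derivable (fun q => GRing.inv (@?a q)) ?p ?v =>
      refine (@derivable_inv _ _ a p v _ _)
  | |- derivable (fun q => GRing.exp (@?a q) ?k) ?p ?v =>
      refine (@derivable_exp _ _ a p v k _)
  end.

(** * Smooth functions on open sets *)

Section SmoothCalculus.
Context {R : realType} {V : normedModType R}.
Implicit Types (U : set V) (f g : V -> R).

(** [Ck_on k] only bounds the derivatives of order exactly [k]; products need
    all the orders up to [k] at once. *)
Definition C_upto {W : normedModType R} (k : nat) U (f : V -> W) : Prop :=
  forall j, (j <= k)%N -> Ck_on j U f.

Lemma smooth_onP {W : normedModType R} U (f : V -> W) :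
  smooth_on U f <-> forall k, C_upto k U f.
Proof.
by split=> [sf k j _|sf k]; [exact: sf | exact: (sf k)].
Qed.

Lemma C_uptoW {W : normedModType R} k U (f : V -> W) :
  C_upto k.+1 U f -> C_upto k U f.
Proof. by move=> cf j jk; apply: cf; apply: leqW. Qed.

Lemma C_upto_cont {W : normedModType R} k U (f : V -> W) : C_upto k U f ->
  forall x, U x -> {for x, continuous f}.
Proof. by move=> cf; exact: (cf 0%N (leq0n _)). Qed.

Lemma C_uptoD {W : normedModType R} k U (f : V -> W) v :
  C_upto k.+1 U f -> C_upto k U ('D_v f).
Proof. by move=> cf j jk; have [_] := cf j.+1 jk; apply. Qed.

Lemma C_upto_derivable {W : normedModType R} k U (f : V -> W) x v :
  C_upto k.+1 U f -> U x -> is_derive x v f ('D_v f x).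
Proof. by move=> cf Ux; apply/derivableP; have [+ _] := cf 1%N isT; exact. Qed.

Lemma C_uptoS {W : normedModType R} k U (f : V -> W) :
  (forall x, U x -> {for x, continuous f}) ->
  (forall x v, U x -> derivable f x v) -> (forall v, C_upto k U ('D_v f)) ->
  C_upto k.+1 U f.
Proof. by move=> c d s [//|j] jk; split=> // v; exact: s. Qed.

Lemma smooth_onD {W : normedModType R} U (f : V -> W) v :
  smooth_on U f -> smooth_on U ('D_v f).
Proof. by move=> sf k; have [_] := sf k.+1; apply. Qed.

Lemma smooth_on_derive {W : normedModType R} U (f : V -> W) x v :
  smooth_on U f -> U x -> is_derive x v f ('D_v f x).
Proof. by move=> sf Ux; apply/derivableP; have [+ _] := sf 1%N; exact. Qed.

Lemma smooth_on_cont {W : normedModType R} U (f : V -> W) x :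
  smooth_on U f -> U x -> {for x, continuous f}.
Proof. by move=> sf Ux; exact: (sf 0%N). Qed.

(** [Ck_on] speaks of total functions, but on an open set it depends only on
    the values there. *)
Lemma Ck_on_eq {W : normedModType R} k U (f g : V -> W) : open U ->
  (forall x, U x -> f x = g x) -> Ck_on k U f -> Ck_on k U g.
Proof.
move=> oU; elim: k f g => [|k IH] f g fg /=.
  move=> cf x Ux; have nfg : \forall y \near x, f y = g y.
    by apply: filterS (open_nbhs_nbhs (conj oU Ux)) => y; exact: fg.
  rewrite /prop_for /continuous_at -fg //.
  exact: (cvg_trans (near_eq_cvg nfg) (cf x Ux)).
move=> [df cf].
have nfg x : U x -> \forall y \near x, f y = g y.
  by move=> Ux; apply: filterS (open_nbhs_nbhs (conj oU Ux)) => y; exact: fg.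
split=> [x v Ux|v]; first exact: near_eq_derivable (nfg _ Ux) (df x v Ux).
apply: IH (cf v) => x Ux; exact: near_eq_derive (nfg _ Ux).
Qed.

Lemma C_upto_eq {W : normedModType R} k U (f g : V -> W) : open U ->
  (forall x, U x -> f x = g x) -> C_upto k U f -> C_upto k U g.
Proof. by move=> oU fg cf j jk; apply: Ck_on_eq (cf j jk). Qed.

Lemma smooth_on_eq {W : normedModType R} U (f g : V -> W) : open U ->
  (forall x, U x -> f x = g x) -> smooth_on U f -> smooth_on U g.
Proof. by move=> oU fg sf k; apply: Ck_on_eq (sf k). Qed.

Lemma smooth_on_cst U (c : R) : smooth_on U (fun _ => c).
Proof.
move=> k; elim: k c => [|k IH] c; first by move=> x Ux; exact: cst_continuous.
split=> [x v _|v]; first exact: derivable_cst.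
suff -> : 'D_v (fun _ : V => c) = fun _ => 0 by exact: IH.
by apply/funext => x; rewrite derive_cst.
Qed.

Lemma C_upto_add k U f g : open U ->
  C_upto k U f -> C_upto k U g -> C_upto k U (fun x => f x + g x).
Proof.
move=> oU; elim: k f g => [|k IH] f g cf cg.
  move=> j; rewrite leqn0 => /eqP-> x Ux.
  by apply: continuousD; [exact: (C_upto_cont cf)|exact: (C_upto_cont cg)].
have D x v : U x -> is_derive x v (fun x => f x + g x) ('D_v f x + 'D_v g x).
  by move=> Ux; apply: is_derive_add; [exact: C_upto_derivable cf Ux|exact: C_upto_derivable cg Ux].
apply: C_uptoS => [x Ux|x v Ux|v].
- by apply: continuousD; [exact: (C_upto_cont cf)|exact: (C_upto_cont cg)].
- by have [] := D x v Ux.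
- apply: (C_upto_eq (f := fun x => 'D_v f x + 'D_v g x)) => //.
    by move=> x Ux; have [_ ->] := D x v Ux.
  by apply: IH; exact: C_uptoD.
Qed.

Lemma C_upto_mul k U f g : open U ->
  C_upto k U f -> C_upto k U g -> C_upto k U (fun x => f x * g x).
Proof.
move=> oU; elim: k f g => [|k IH] f g cf cg.
  move=> j; rewrite leqn0 => /eqP-> x Ux.
  by apply: continuousM; [exact: (C_upto_cont cf)|exact: (C_upto_cont cg)].
have D x v : U x ->
    is_derive x v (fun x => f x * g x) ('D_v f x * g x + f x * 'D_v g x).
  by move=> Ux; apply: is_derive_mul; [exact: C_upto_derivable cf Ux|exact: C_upto_derivable cg Ux].
apply: C_uptoS => [x Ux|x v Ux|v].
- by apply: continuousM; [exact: (C_upto_cont cf)|exact: (C_upto_cont cg)].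
- by have [] := D x v Ux.
- apply: (C_upto_eq (f := fun x => 'D_v f x * g x + f x * 'D_v g x)) => //.
    by move=> x Ux; have [_ ->] := D x v Ux.
  by apply: C_upto_add => //; apply: IH; (exact: C_uptoD || exact: C_uptoW).
Qed.

Lemma C_upto_inv k U f : open U -> (forall x, U x -> f x != 0) ->
  C_upto k U f -> C_upto k U (fun x => (f x)^-1).
Proof.
move=> oU f0; elim: k => [|k IH] cf.
  move=> j; rewrite leqn0 => /eqP-> x Ux.
  by apply: continuousV; [exact: f0|exact: (C_upto_cont cf)].
have D x v : U x ->
    is_derive x v (fun x => (f x)^-1) (- (f x) ^- 2 * 'D_v f x).
  by move=> Ux; apply: is_derive_inv; [exact: f0 | exact: C_upto_derivable cf _].
have ci := IH (C_uptoW cf).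
apply: C_uptoS => [x Ux|x v Ux|v].
- by apply: continuousV; [exact: f0|exact: (C_upto_cont cf)].
- by have [] := D x v Ux.
- apply: (C_upto_eq (f := fun x => (-1) * ((f x)^-1 * (f x)^-1) * 'D_v f x)) => //.
    by move=> x Ux; have [_ ->] := D x v Ux; rewrite mulN1r -invfM -expr2.
  apply: C_upto_mul => //; last exact: C_uptoD.
  apply: C_upto_mul => //; last exact: C_upto_mul.
  by move=> j jk; exact: smooth_on_cst.
Qed.

Lemma smooth_on_add U f g : open U ->
  smooth_on U f -> smooth_on U g -> smooth_on U (fun x => f x + g x).
Proof.
by move=> oU /smooth_onP sf /smooth_onP sg; apply/smooth_onP => k; exact: C_upto_add.
Qed.

Lemma smooth_on_mul U f g : open U ->
  smooth_on U f -> smooth_on U g -> smooth_on U (fun x => f x * g x).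
Proof.
by move=> oU /smooth_onP sf /smooth_onP sg; apply/smooth_onP => k; exact: C_upto_mul.
Qed.

Lemma smooth_on_inv U f : open U -> (forall x, U x -> f x != 0) ->
  smooth_on U f -> smooth_on U (fun x => (f x)^-1).
Proof.
by move=> oU f0 /smooth_onP sf; apply/smooth_onP => k; exact: C_upto_inv.
Qed.

Lemma smooth_on_sub U f g : open U ->
  smooth_on U f -> smooth_on U g -> smooth_on U (fun x => f x - g x).
Proof.
move=> oU sf sg.
have -> : (fun x => f x - g x) = (fun x => f x + (-1) * g x).
  by apply/funext => x; rewrite mulN1r.
apply: smooth_on_add => //; apply: smooth_on_mul => //; exact: smooth_on_cst.
Qed.

Lemma smooth_on_exp U f n : open U ->
  smooth_on U f -> smooth_on U (fun x => f x ^+ n).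
Proof.
move=> oU sf; elim: n => [|n IH].
  by rewrite (_ : (fun x => _) = fun=> 1) //; exact: smooth_on_cst.
rewrite (_ : (fun x => _) = fun x => f x * f x ^+ n); first exact: smooth_on_mul.
by apply/funext => x; rewrite exprS.
Qed.

Lemma smooth_on_sum m U (f : 'I_m -> V -> R) : open U ->
  (forall i, smooth_on U (f i)) -> smooth_on U (fun x => \sum_i f i x).
Proof.
move=> oU; elim: m f => [|m IH] f sf.
  rewrite (_ : (fun x => _) = fun=> 0); first exact: smooth_on_cst.
  by apply/funext => x; rewrite big_ord0.
rewrite (_ : (fun x => _) =
  (fun x => \sum_(i < m) f (widen_ord (leqnSn m) i) x + f ord_max x)).
  by apply: smooth_on_add => //; exact: IH.
by apply/funext => x; rewrite big_ord_recr.
Qed.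

(** A function whose directional derivatives are constant is smooth as soon as
    it is continuous: this covers the linear coordinates. *)
Lemma smooth_on_affine U f (df : V -> R) :
  continuous f -> (forall x v, is_derive x v f (df v)) -> smooth_on U f.
Proof.
move=> cf D [|k]; first by move=> x _; exact: cf.
split=> [x v _|v]; first by have [] := D x v.
suff -> : 'D_v f = fun _ => df v by exact: smooth_on_cst.
by apply/funext => x; have [] := D x v.
Qed.

End SmoothCalculus.

Section SmoothOneVariable.
Context {R : realType}.
Implicit Types (I : set R) (phi psi : R -> R) (t : R).

Lemma is_derive1_dir phi t (v d : R) :
  is_derive t 1 phi d -> is_derive t v phi (v * d).
Proof.
move=> h; rewrite mulrC; apply: (is_derive_compose (f := id) h).
Qed.

Lemma is_derive1_cont phi t (d : R) : is_derive t 1 phi d -> {for t, continuous phi}.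
Proof. by move=> [/derivable1_diffP/differentiable_continuous]. Qed.

Lemma smooth_on_is_derive1 I phi t : smooth_on I phi -> I t ->
  is_derive t 1 phi (derive1 phi t).
Proof. by move=> sf It; rewrite derive1E; exact: smooth_on_derive It. Qed.

Lemma smooth_on_derive1 I phi : smooth_on I phi -> smooth_on I (derive1 phi).
Proof.
move=> sf; have -> : derive1 phi = 'D_1 phi.
  by apply/funext => t; rewrite derive1E.
exact: smooth_onD.
Qed.

Lemma C_upto_primitive k I phi psi : open I ->
  (forall t, I t -> is_derive t 1 phi (psi t)) -> C_upto k I psi ->
  C_upto k.+1 I phi.
Proof.
move=> oI D cpsi; apply: C_uptoS => [t It|t v It|v].
- exact: is_derive1_cont (D t It).
- by have [] := is_derive1_dir v (D t It).
- apply: (C_upto_eq (f := fun t => v * psi t)) => //.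
    by move=> t It; have [_ ->] := is_derive1_dir v (D t It).
  apply: C_upto_mul => //; move=> j _; exact: smooth_on_cst.
Qed.

(** This is how the antiderivative fixed in the admissibility condition enters
    a smooth metric. *)
Lemma smooth_on_primitive I phi psi : open I ->
  (forall t, I t -> is_derive t 1 phi (psi t)) -> smooth_on I psi ->
  smooth_on I phi.
Proof.
move=> oI D /smooth_onP s; apply/smooth_onP => k.
exact/C_uptoW/(C_upto_primitive oI D).
Qed.

Lemma smooth_on_id I : open I -> smooth_on I (fun t : R => t).
Proof.
move=> oI; apply: (smooth_on_primitive (psi := fun _ => 1)) => //.
exact: smooth_on_cst.
Qed.

(** The derivative of the square root is the inverse of twice the square root,
    so regularity is gained one order at a time. *)
Lemma smooth_on_sqrt I : open I -> (forall t, I t -> 0 < t) ->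
  smooth_on I (Num.sqrt : R -> R).
Proof.
move=> oI pos; apply/smooth_onP; elim=> [|k IH].
  move=> j; rewrite leqn0 => /eqP-> t It.
  exact: is_derive1_cont (is_derive1_sqrt (pos t It)).
apply: (C_upto_primitive (psi := fun t => (2 * Num.sqrt t)^-1)) => //.
  by move=> t It; exact: is_derive1_sqrt (pos t It).
apply: C_upto_inv => // [t It|].
  by rewrite mulf_neq0 ?pnatr_eq0// gt_eqF// sqrtr_gt0 pos.
apply: C_upto_mul => //; move=> j _; exact: smooth_on_cst.
Qed.

End SmoothOneVariable.

Section SmoothComposition.
Context {R : realType} {V : normedModType R}.

Lemma smooth_on_comp (U : set V) (I : set R) (f : V -> R) (phi : R -> R) :
  open U -> open I -> (forall x, U x -> I (f x)) ->
  smooth_on U f -> smooth_on I phi -> smooth_on U (fun x => phi (f x)).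
Proof.
move=> oU oI UI sf sphi; apply/smooth_onP => k; elim: k phi sphi => [|k IH] phi sphi.
  move=> j; rewrite leqn0 => /eqP-> x Ux; apply: continuous_comp.
    exact: smooth_on_cont sf Ux.
  exact: smooth_on_cont sphi (UI _ Ux).
have D x v : U x ->
    is_derive x v (fun x => phi (f x)) (derive1 phi (f x) * 'D_v f x).
  move=> Ux; apply: is_derive_compose; last exact: smooth_on_derive Ux.
  exact: smooth_on_is_derive1 (UI _ Ux).
apply: C_uptoS => [x Ux|x v Ux|v].
- apply: continuous_comp; first exact: smooth_on_cont sf Ux.
  exact: smooth_on_cont sphi (UI _ Ux).
- by have [] := D x v Ux.
- apply: (C_upto_eq (f := fun x => derive1 phi (f x) * 'D_v f x)) => //.
    by move=> x Ux; have [_ ->] := D x v Ux.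
  apply: C_upto_mul => //; first exact/IH/smooth_on_derive1.
  by move=> j _; exact: smooth_onD.
Qed.

(** Along a ray the parameter is the square of the distance to the origin, hence
    the reparametrisation [s]. *)
Lemma smooth_on_ray (U : set V) (I : set R) (e : V) (f : V -> R) (s : R -> R) :
  open U -> open I -> (forall t, I t -> U (s t *: e)) ->
  smooth_on I s -> smooth_on U f -> smooth_on I (fun t => f (s t *: e)).
Proof.
move=> oU oI IU ss sf; apply/smooth_onP => k; elim: k f sf => [|k IH] f sf.
  move=> j; rewrite leqn0 => /eqP-> t It.
  apply: (@continuous_comp _ _ _ (fun t => s t *: e) f); last first.
    exact: smooth_on_cont sf (IU _ It).
  by apply: continuousZr_tmp; exact: smooth_on_cont ss It.
have D1 t : I t ->
    is_derive t 1 (fun t => f (s t *: e)) ('D_e f (s t *: e) * derive1 s t).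
  move=> It; apply: (is_derive_compose (phi := fun x => f (x *: e))); last first.
    exact: smooth_on_is_derive1 It.
  apply/is_derive_line.
  have /is_derive_line := smooth_on_derive e sf (IU _ It).
  congr is_derive; apply/funext => h; congr f.
  by rewrite scalerDl [_%:A]mulr1.
apply: (C_upto_primitive (psi := fun t => 'D_e f (s t *: e) * derive1 s t)) => //.
apply: C_upto_mul => //; first exact: (IH ('D_e f) (smooth_onD e sf)).
by move=> j _; exact: smooth_on_derive1.
Qed.

End SmoothComposition.

(** * Real geometry of complex n-space *)

Section RealHermitianGeometry.
Context {R : realType} {n : nat}.
Local Open Scope complex_scope.
Implicit Types (p u v w x : 'rV[R]_(n + n)) (E F b : R -> R).

Definition dot {m} (u v : 'rV[R]_m) : R := (u *m v^T) 0 0.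

Lemma dotE {m} (u v : 'rV[R]_m) : dot u v = \sum_a u 0 a * v 0 a.
Proof. by rewrite /dot mxE; apply: eq_bigr => a _; rewrite !mxE. Qed.

Lemma dotC {m} (u v : 'rV[R]_m) : dot u v = dot v u.
Proof. by rewrite !dotE; apply: eq_bigr => a _; rewrite mulrC. Qed.

Lemma dotDl {m} (u v w : 'rV[R]_m) : dot (u + v) w = dot u w + dot v w.
Proof. by rewrite /dot mulmxDl mxE. Qed.

Lemma dotZl {m} (c : R) (u v : 'rV[R]_m) : dot (c *: u) v = c * dot u v.
Proof. by rewrite /dot -scalemxAl mxE. Qed.

Lemma dotNl {m} (u v : 'rV[R]_m) : dot (- u) v = - dot u v.
Proof. by rewrite -scaleN1r dotZl mulN1r. Qed.

Lemma dotDr {m} (u v w : 'rV[R]_m) : dot u (v + w) = dot u v + dot u w.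
Proof. by rewrite dotC dotDl !(dotC u). Qed.

Lemma dotZr {m} (c : R) (u v : 'rV[R]_m) : dot u (c *: v) = c * dot u v.
Proof. by rewrite dotC dotZl dotC. Qed.

Lemma dotNr {m} (u v : 'rV[R]_m) : dot u (- v) = - dot u v.
Proof. by rewrite dotC dotNl dotC. Qed.

Lemma dot_basis {m} (u : 'rV[R]_m) k : dot u (std_basis k) = u 0 k.
Proof.
rewrite dotE (bigD1 k) //= big1 ?addr0 => [|i ik]; rewrite !mxE eqxx /=.
  by rewrite eqxx mulr1.
by rewrite (negbTE ik) mulr0.
Qed.

(** Tensors are written with dot products against the standard basis; all
    contractions of a repeated index then reduce to this formula. *)
Lemma sum_dot_basis {m} (u v : 'rV[R]_m) :
  \sum_i dot u (std_basis i) * dot v (std_basis i) = dot u v.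
Proof. by rewrite dotE; apply: eq_bigr => i _; rewrite !dot_basis. Qed.

Lemma dot_basis_basis {m} (i j : 'I_m) :
  dot (std_basis i) (std_basis j) = (i == j)%:R.
Proof. by rewrite dot_basis mxE eqxx eq_sym. Qed.

Lemma dot_gt0 {m} (u : 'rV[R]_m) : u != 0 -> 0 < dot u u.
Proof.
move=> u0; have [k uk] : exists k, u 0 k != 0.
  apply/existsP; apply: contraNT u0; rewrite negb_exists => /forallP h.
  by apply/eqP/rowP => k; rewrite mxE; apply/eqP; have := h k; rewrite negbK.
rewrite dotE (bigD1 k) //= ltr_pwDl //; first by rewrite -expr2 exprn_even_gt0.
by apply: sumr_ge0 => i _; rewrite -expr2 sqr_ge0.
Qed.

Lemma dot_ge0 {m} (u : 'rV[R]_m) : 0 <= dot u u.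
Proof. by rewrite dotE; apply: sumr_ge0 => i _; rewrite -expr2 sqr_ge0. Qed.

Lemma J0D u v : J0 (u + v) = J0 u + J0 v.
Proof. by rewrite /J0 !linearD /= add_row_mx ?opprD. Qed.

Lemma J0Z (c : R) u : J0 (c *: u) = c *: J0 u.
Proof. by rewrite /J0 !linearZ /= scale_row_mx scalerN. Qed.

Lemma J0N u : J0 (- u) = - J0 u.
Proof. by rewrite -scaleN1r J0Z scaleN1r. Qed.

Lemma J0K u : J0 (J0 u) = - u.
Proof.
rewrite /J0 row_mxKl row_mxKr -{3}(hsubmxK u) opp_row_mx //.
Qed.

Lemma dot_split u v :
  dot u v = dot (lsubmx u) (lsubmx v) + dot (rsubmx u) (rsubmx v).
Proof.
rewrite -{1}(hsubmxK u) -{1}(hsubmxK v) /dot tr_row_mx mul_row_col mxE //.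
Qed.

Lemma dot_J0r u v : dot u (J0 v) = - dot (J0 u) v.
Proof.
rewrite !dot_split /J0 !row_mxKl !row_mxKr dotNr dotNl; ring.
Qed.

Lemma dot_J0J0 u v : dot (J0 u) (J0 v) = dot u v.
Proof. by rewrite dot_J0r J0K dotNl opprK. Qed.

Lemma dot_J0_diag u : dot (J0 u) u = 0.
Proof.
have h := dot_J0r u u; rewrite (dotC u) in h.
lra.
Qed.

Lemma zsqE p : zsq p = dot p p.
Proof.
by rewrite dot_split !dotE -big_split; apply: eq_bigr => i _; rewrite -!expr2.
Qed.

Lemma toCK u : ofC (toC u) = u.
Proof.
rewrite /ofC -[RHS]hsubmxK; congr row_mx; apply/rowP => i; rewrite !mxE //.
Qed.

Lemma ofCK (z : 'rV[R[i]]_n) : toC (ofC z) = z.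
Proof.
by apply/rowP => i; rewrite /toC /ofC row_mxKl row_mxKr !mxE; case: (z 0 i).
Qed.

Lemma toC_J0 u : toC (J0 u) = 'i%C *: toC u.
Proof.
apply/rowP => i; rewrite /toC /J0 row_mxKl row_mxKr !mxE.
by apply/eqP; rewrite eq_complex /=; apply/andP; split; apply/eqP; ring.
Qed.

(** Up to sign the imaginary part of the Hermitian product is the Kaehler form,
    so real linear maps that commute with [J0] preserve one product iff they preserve the other. *)
Lemma dotmx_toC u v : dotmx (toC u) (toC v) = dot u v +i* dot u (J0 v).
Proof.
rewrite dotmxE mxE.
rewrite !dot_split /J0 row_mxKl row_mxKr dotNr !dotE.
rewrite -sumrN -!big_split /=.
rewrite (eq_bigr (fun i => (lsubmx u 0 i * lsubmx v 0 i + rsubmx u 0 i * rsubmx v 0 i)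
  +i* (- (lsubmx u 0 i * rsubmx v 0 i) + rsubmx u 0 i * lsubmx v 0 i))).
  by elim/big_rec3: _ => // i a1 a2 a3 _ ->.
move=> i _; rewrite !mxE.
by apply/eqP; rewrite eq_complex /=; apply/andP; split; apply/eqP; ring.
Qed.

Lemma toC_cact (A : 'M[R[i]]_n) u : toC (cact A u) = toC u *m A^T.
Proof. exact: ofCK. Qed.

Lemma J0_cact (A : 'M[R[i]]_n) u : J0 (cact A u) = cact A (J0 u).
Proof. by rewrite -[LHS]toCK toC_J0 toC_cact scalemxAl -toC_J0. Qed.

Lemma cactM (A B : 'M[R[i]]_n) u : cact A (cact B u) = cact (A *m B) u.
Proof. by rewrite /cact ofCK trmx_mul mulmxA. Qed.

Lemma cact1 u : cact 1%:M u = u.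
Proof. by rewrite /cact trmx1 mulmx1 toCK. Qed.

Lemma dot_cact (A : 'M[R[i]]_n) u v : A \is unitarymx ->
  dot (cact A u) (cact A v) = dot u v.
Proof.
rewrite -trmx_unitary => /unitarymxP uA.
suff : dotmx (toC (cact A u)) (toC (cact A v)) = dotmx (toC u) (toC v).
  by rewrite !dotmx_toC => -[].
by rewrite !toC_cact !dotmxE trmx_mul map_mxM mulmxA -(mulmxA (toC u)) uA mulmx1.
Qed.

(** The Fubini-Study form is the Euclidean one with its part along [p] and
    [J0 p] removed, so [Un_metric] is a rank-two perturbation of a multiple of
    the Euclidean metric; see [Un_metricE]. *)
Definition rot_form (f b : R) p u v : R :=
  f * dot u v + b * (dot p u * dot p v + dot (J0 p) u * dot (J0 p) v).

Definition rot_mx (f b : R) p : 'M[R]_(n + n) :=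
  f%:M + b *: (p^T *m p + (J0 p)^T *m J0 p).

Lemma rot_mxE (f b : R) p i j :
  rot_mx f b p i j = rot_form f b p (std_basis i) (std_basis j).
Proof.
have H (u : 'rV[R]_(n + n)) : (u^T *m u) i j = u 0 i * u 0 j.
  by rewrite !mxE big_ord1 !mxE.
rewrite /rot_form dot_basis_basis !dot_basis /rot_mx mxE.
by rewrite [X in X + _]mxE [X in _ + X]mxE [X in _ * X]mxE !H mulr_natr.
Qed.

Lemma inner_rot_mx (f b : R) p u v :
  (u *m rot_mx f b p *m v^T) 0 0 = rot_form f b p u v.
Proof.
have H (x : 'rV[R]_(n + n)) : (u *m (x^T *m x) *m v^T) 0 0 = dot x u * dot x v.
  by rewrite mulmxA -(mulmxA (u *m x^T)) mxE big_ord1 (dotC x u).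
have D (M N : 'M[R]_1) : (M + N) 0 0 = M 0 0 + N 0 0 by rewrite mxE.
have Z (c : R) (M : 'M[R]_1) : (c *: M) 0 0 = c * M 0 0 by rewrite mxE.
rewrite /rot_mx mulmxDr mul_mx_scalar mulmxDl -scalemxAl D Z.
by rewrite -scalemxAr -scalemxAl Z mulmxDr mulmxDl D !H.
Qed.

Lemma rot_form_cact (A : 'M[R[i]]_n) (f b : R) p u v : A \is unitarymx ->
  rot_form f b (cact A p) (cact A u) (cact A v) = rot_form f b p u v.
Proof. by move=> uA; rewrite /rot_form J0_cact !(dot_cact _ _ uA). Qed.

Lemma rot_form_J0 (f b : R) p u v :
  rot_form f b p (J0 u) (J0 v) = rot_form f b p u v.
Proof. by rewrite /rot_form !dot_J0J0 !(dot_J0r p); ring. Qed.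

Lemma is_derive_dotl p u v : is_derive p v (fun q => dot q u) (dot v u).
Proof.
apply/is_derive_line.
rewrite (_ : (fun h => _) = fun h : R => h * dot v u + dot p u); last first.
  by apply/funext => h; rewrite dotDl dotZl.
apply: (@is_derive_eq _ _ _ _ _ _ _ (1 * dot v u + (0 : R) * 0 + 0)); last by ring.
by apply: is_derive_add; apply: is_derive_mul.
Qed.

Lemma is_derive_dot_J0l p u v :
  is_derive p v (fun q => dot (J0 q) u) (dot (J0 v) u).
Proof.
rewrite (_ : (fun q => _) = fun q => dot q (- J0 u)); last first.
  by apply/funext => q; rewrite dotNr dot_J0r opprK.
by rewrite -[dot (J0 v) u]opprK -dot_J0r -dotNr; exact: is_derive_dotl.
Qed.

Lemma is_derive_coord {m} (p v : 'rV[R]_m) a :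
  is_derive p v (fun q : 'rV[R]_m => q 0 a) (v 0 a).
Proof.
apply/is_derive_line.
rewrite (_ : (fun h => _) = fun h : R => h * v 0 a + p 0 a); last first.
  by apply/funext => h; rewrite !mxE.
apply: (@is_derive_eq _ _ _ _ _ _ _ (1 * v 0 a + (0 : R) * 0 + 0)); last by ring.
by apply: is_derive_add; apply: is_derive_mul.
Qed.

Lemma smooth_on_coord {m} (U : set 'rV[R]_m) a :
  smooth_on U (fun q : 'rV[R]_m => q 0 a).
Proof.
apply: (@smooth_on_affine R _ U _ (fun v : 'rV[R]_m => v 0 a)).
  exact: coord_continuous.
by move=> x v; exact: is_derive_coord.
Qed.

Lemma smooth_on_dot {m k} (U : set 'rV[R]_m) (f g : 'rV[R]_m -> 'rV[R]_k) :
  open U -> (forall a, smooth_on U (fun q => f q 0 a)) ->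
  (forall a, smooth_on U (fun q => g q 0 a)) ->
  smooth_on U (fun q => dot (f q) (g q)).
Proof.
move=> oU sf sg.
rewrite (_ : (fun q => _) = fun q => \sum_a f q 0 a * g q 0 a); last first.
  by apply/funext => q; rewrite dotE.
by apply: smooth_on_sum => // a; exact: smooth_on_mul.
Qed.

Lemma smooth_on_J0 (U : set 'rV[R]_(n + n)) a : open U ->
  smooth_on U (fun q => J0 q 0 a).
Proof.
move=> oU.
rewrite (_ : (fun q => _) = fun q => dot q (- J0 (std_basis a))); last first.
  by apply/funext => q; rewrite dotNr dot_J0r opprK dot_basis.
by apply: smooth_on_dot => // i; (exact: smooth_on_coord || exact: smooth_on_cst).
Qed.

Lemma is_derive_zsq p v : is_derive p v zsq (2 * dot p v).
Proof.
rewrite (_ : zsq = fun q => \sum_a q 0 a * q 0 a); last first.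
  by apply/funext => q; rewrite zsqE dotE.
apply: (@is_derive_eq _ _ _ _ _ _ _
         (\sum_a (v 0 a * p 0 a + p 0 a * v 0 a))); last first.
  by rewrite dotE mulr_sumr; apply: eq_bigr => a _; ring.
by apply: is_derive_sums => a; apply: is_derive_mul; exact: is_derive_coord.
Qed.

Lemma smooth_on_zsq (U : set 'rV[R]_(n + n)) : open U -> smooth_on U zsq.
Proof.
move=> oU; rewrite (_ : zsq = fun q => dot q q); last by apply/funext => q; rewrite zsqE.
by apply: smooth_on_dot => // a; exact: smooth_on_coord.
Qed.

Lemma continuous_zsq : continuous (zsq : 'rV[R]_(n + n) -> R).
Proof.
by move=> p; apply: (smooth_on_cont (U := setT)) => //; exact: (smooth_on_zsq openT).
Qed.

Lemma open_radii (alpha : R) (beta : \bar R) : open (radii alpha beta).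
Proof.
rewrite (_ : radii alpha beta =
    ([set t | alpha < t] `&` [set t : R | (t%:E < beta)%E])%classic).
  apply: openI; first exact: open_gt.
  case: beta => [b| |].
  - by rewrite (_ : mkset _ = [set t | t < b]%classic) //; exact: open_lt.
  - rewrite (_ : mkset _ = setT); first exact: openT.
    by apply/seteqP; split=> t //= _; exact: ltry.
  - rewrite (_ : mkset _ = set0); first exact: open0.
    by apply/seteqP; split=> t //=.
by apply/seteqP; split=> t; rewrite /radii /= lte_fin; [case/andP|case=> -> ->].
Qed.

Lemma open_annulus (alpha : R) (beta : \bar R) :
  open (annulus alpha beta : set 'rV[R]_(n + n)).
Proof.
have -> : annulus alpha beta = (zsq @^-1` radii alpha beta)%classic by [].
apply: open_comp; first by move=> p _; exact: continuous_zsq.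
exact: open_radii.
Qed.

Lemma d_sqrt_zsqE p u : 0 < zsq p -> d_sqrt_zsq p u = dot p u / Num.sqrt (zsq p).
Proof.
move=> p0; have [_] : is_derive p u (fun q => Num.sqrt (zsq q))
    ((2 * Num.sqrt (zsq p))^-1 * (2 * dot p u)).
  exact: (is_derive_compose (is_derive1_sqrt p0) (is_derive_zsq p u)).
rewrite /d_sqrt_zsq => ->.
have s0 : Num.sqrt (zsq p) != 0 by rewrite gt_eqF ?sqrtr_gt0.
by field.
Qed.

Lemma fubini_studyE p u v : fubini_study p u v =
  (zsq p * dot u v - (dot p u * dot p v + dot (J0 p) u * dot (J0 p) v)) / zsq p ^+ 2.
Proof.
rewrite /fubini_study !dotmx_toC /=; congr (_ / _).
by rewrite !dot_J0r (dotC u p) (dotC (J0 u) p) dot_J0r; ring.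
Qed.

Lemma Un_metricE E F p : 0 < zsq p ->
  Un_metric E F p = rot_mx (F (zsq p)) ((E (zsq p) - F (zsq p)) / zsq p) p.
Proof.
move=> p0; apply/matrixP => i j; rewrite rot_mxE mxE !d_sqrt_zsqE // fubini_studyE.
rewrite /h_fiber /hopf_coform -!/(dot _ _) /rot_form.
have s0 : Num.sqrt (zsq p) != 0 by rewrite gt_eqF ?sqrtr_gt0.
have z0 : zsq p != 0 by rewrite gt_eqF.
set a := dot p _; set b := dot p _; set c := dot (J0 p) _; set d := dot (J0 p) _.
have -> : a / Num.sqrt (zsq p) * (b / Num.sqrt (zsq p)) = a * b / zsq p.
  by rewrite -{3}(sqr_sqrtr (ltW p0)); field.
by field.
Qed.

End RealHermitianGeometry.

(** * Scalar curvature in divergence form *)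

Section DivergenceForm.
Context {R : realType} {m : nat}.
Implicit Types (g : 'rV[R]_m -> 'M[R]_m) (p : 'rV[R]_m).

Definition christoffel_trace_up g (i : 'I_m) p : R :=
  \sum_j \sum_k invmx (g p) j k * christoffel g i j k p.

Definition christoffel_trace_low g (k : 'I_m) p : R :=
  \sum_i christoffel g i i k p.

Lemma pd_sum (k : 'I_m) r (f : 'I_r -> 'rV[R]_m -> R) p :
  (forall i, derivable (f i) p (std_basis k)) ->
  pd k (fun q => \sum_i f i q) p = \sum_i pd k (f i) p.
Proof.
by move=> df; have [_] := is_derive_sums (fun i => derivableP (df i)).
Qed.

Lemma pd_mul (k : 'I_m) (f h : 'rV[R]_m -> R) p :
  derivable f p (std_basis k) -> derivable h p (std_basis k) ->
  pd k (fun q => f q * h q) p = pd k f p * h p + f p * pd k h p.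
Proof.
by move=> df dh; have [_] := is_derive_mul (derivableP df) (derivableP dh).
Qed.

(** Moving the derivatives of the Christoffel symbols outside of the
    contractions costs the derivatives of the inverse metric; since the metric
    is parallel these are again Christoffel symbols, and half of the resulting
    quadratic term survives. *)
Lemma scalar_curvature_divergence g p :
  (forall i j k l, derivable (christoffel g i j k) p (std_basis l)) ->
  (forall i j l, derivable (fun q => invmx (g q) i j) p (std_basis l)) ->
  (forall i j k, christoffel g i j k p = christoffel g i k j p) ->
  (forall s i k, pd s (fun q => invmx (g q) i k) p =
     - \sum_j (christoffel g i s j p * invmx (g p) j k
               + christoffel g k s j p * invmx (g p) j i)) ->
  scalar_curvature g p =
    \sum_i pd i (christoffel_trace_up g i) p
    - \sum_j \sum_k invmx (g p) j k * pd j (christoffel_trace_low g k) p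
    + \sum_s christoffel_trace_low g s p * christoffel_trace_up g s p
    - 2^-1 * \sum_s \sum_i \sum_k
        pd s (fun q => invmx (g q) i k) p * christoffel g s i k p.
Proof.
move=> dG dI symG compat.
pose Gam i j k := christoffel g i j k p.
pose gi j k := invmx (g p) j k.
pose dgi s i k := pd s (fun q => invmx (g q) i k) p.
have {}symG i j k : Gam i j k = Gam i k j by exact: symG.
have {}compat s i k : dgi s i k =
  - \sum_j (Gam i s j * gi j k + Gam k s j * gi j i) by exact: compat.
pose S1 := \sum_j \sum_k gi j k * \sum_i pd i (christoffel g i j k) p.
pose S2 := \sum_j \sum_k gi j k * \sum_i pd j (christoffel g i i k) p.
pose S3 := \sum_j \sum_k gi j k * \sum_i \sum_s Gam i i s * Gam s j k.
pose S4 := \sum_j \sum_k gi j k * \sum_i \sum_s Gam i j s * Gam s i k.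
set Qd := \sum_s \sum_i \sum_k dgi s i k * Gam s i k.
have T1 : S1 =
    \sum_i pd i (christoffel_trace_up g i) p - Qd.
  rewrite /S1; apply/esym/eqP; rewrite subr_eq addrC; apply/eqP.
  have -> : \sum_j \sum_k gi j k * \sum_i pd i (christoffel g i j k) p =
      \sum_i \sum_j \sum_k gi j k * pd i (christoffel g i j k) p.
    rewrite [RHS]exchange_big; apply: eq_bigr => j _ /=.
    by rewrite [RHS]exchange_big; apply: eq_bigr => k _ /=; rewrite mulr_sumr.
  rewrite -big_split; apply: eq_bigr => i _ /=.
  rewrite pd_sum => [|j]; last first.
    by apply: derivable_sums => k; apply: derivable_mul.
  rewrite -big_split; apply: eq_bigr => j _ /=.
  rewrite pd_sum => [|k]; last by apply: derivable_mul.
  rewrite -big_split; apply: eq_bigr => k _ /=.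
  by rewrite pd_mul.
have T2 : S2 =
    \sum_j \sum_k gi j k * pd j (christoffel_trace_low g k) p.
  apply: eq_bigr => j _; apply: eq_bigr => k _; congr (_ * _).
  by rewrite pd_sum.
have T3 : S3 =
    \sum_s christoffel_trace_low g s p * christoffel_trace_up g s p.
  rewrite [RHS](eq_bigr (fun s => \sum_j \sum_k christoffel_trace_low g s p *
      (gi j k * Gam s j k))); last first.
    move=> s _; rewrite mulr_sumr; apply: eq_bigr => j _.
    by rewrite mulr_sumr.
  rewrite [RHS]exchange_big; apply: eq_bigr => j _ /=.
  rewrite [RHS]exchange_big; apply: eq_bigr => k _ /=.
  rewrite exchange_big mulr_sumr; apply: eq_bigr => s _ /=.
  by rewrite -mulr_suml mulrCA.
have T4 : S4 =
    - (2^-1 * Qd).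
  set T := S4.
  (* Exchanging [i] and [k] leaves [T] unchanged, so the two halves of [compat]
     contribute equally. *)
  have E1 : \sum_s \sum_i \sum_k (\sum_j Gam i s j * gi j k) * Gam s i k = T.
    rewrite /T /S4.
    have -> : \sum_j \sum_k gi j k * \sum_i \sum_s Gam i j s * Gam s i k =
        \sum_j \sum_k \sum_i \sum_s gi j k * (Gam i j s * Gam s i k).
      apply: eq_bigr => j _; apply: eq_bigr => k _.
      by rewrite mulr_sumr; apply: eq_bigr => i _; rewrite mulr_sumr.
    have -> : \sum_s \sum_i \sum_k (\sum_j Gam i s j * gi j k) * Gam s i k =
        \sum_s \sum_i \sum_k \sum_j gi j k * (Gam i j s * Gam s i k).
      apply: eq_bigr => s _; apply: eq_bigr => i _; apply: eq_bigr => k _.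
      rewrite mulr_suml; apply: eq_bigr => j _.
      by rewrite (symG i s j); ring.
    rewrite (eq_bigr (fun s => \sum_k \sum_i \sum_j
      gi j k * (Gam i j s * Gam s i k))); last by move=> s _; rewrite exchange_big.
    rewrite exchange_big [RHS]exchange_big; apply: eq_bigr => k _ /=.
    rewrite (eq_bigr (fun s => \sum_j \sum_i
      gi j k * (Gam i j s * Gam s i k))); last by move=> s _; rewrite exchange_big.
    rewrite exchange_big; apply: eq_bigr => j _ /=.
    by rewrite exchange_big.
  have E2 : \sum_s \sum_i \sum_k (\sum_j Gam k s j * gi j i) * Gam s i k = T.
    rewrite -E1; apply: eq_bigr => s _; rewrite exchange_big.
    apply: eq_bigr => i _; apply: eq_bigr => k _ /=.
    by rewrite (symG s k i).
  have -> : Qd = - (T + T).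
    rewrite -{1}E1 -E2 -big_split -sumrN; apply: eq_bigr => s _ /=.
    rewrite -big_split -sumrN; apply: eq_bigr => i _ /=.
    rewrite -big_split -sumrN; apply: eq_bigr => k _ /=.
    by rewrite compat big_split /= mulNr mulrDl.
  by field.
rewrite /scalar_curvature.
have -> : \sum_j \sum_k invmx (g p) j k * ricci g j k p = S1 - S2 + S3 - S4.
  rewrite -!sumrB -big_split -sumrB; apply: eq_bigr => j _ /=.
  rewrite -!sumrB -big_split -sumrB; apply: eq_bigr => k _ /=.
  rewrite -!mulrBr -mulrDr -mulrBr; congr (_ * _); rewrite /ricci.
  rewrite -!sumrB -big_split -sumrB; apply: eq_bigr => i _ /=.
  by rewrite /riemann sumrB addrA.
have alg (a b c d : R) : a - d - b + c - - (2^-1 * d) = a - b + c - 2^-1 * d.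
  by field.
by rewrite T1 T2 T3 T4 alg.
Qed.

End DivergenceForm.

(** * Curvature of rank-two perturbations of the Euclidean metric *)

Section RotationalTensors.
Context {R : realType} {n : nat}.
Implicit Types (p u v w x y : 'rV[R]_(n + n)).
Local Notation e_ i := (std_basis i : 'rV[R]_(n + n)).

Lemma dot_basis_diag i : dot (e_ i) (e_ i) = 1.
Proof. by rewrite dot_basis_basis eqxx. Qed.

Lemma dot_p_J0p p : dot p (J0 p) = 0.
Proof. by rewrite dotC dot_J0_diag. Qed.

Lemma dot_J0p_J0p p : dot (J0 p) (J0 p) = zsq p.
Proof. by rewrite dot_J0J0 zsqE. Qed.

Lemma dot_swapJ0 u v : dot (J0 u) v = - dot (J0 v) u.
Proof. by rewrite dotC dot_J0r. Qed.

(** The rank-two part [M] satisfies [M *m M = zsq p *: M], so the inverse is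
    again of the form [rot_mx]. *)
Lemma invmx_rot_mx (f b : R) p : f != 0 -> f + zsq p * b != 0 ->
  invmx (rot_mx f b p) = rot_mx f^-1 (- b / (f * (f + zsq p * b))) p.
Proof.
move=> f0 e0; set c := - b / _.
have sq x : x *m x^T = (dot x x)%:M.
  by rewrite [LHS]mx11_scalar.
have s0 x y : dot x y = 0 -> x *m y^T = 0.
  by move=> xy; rewrite [LHS]mx11_scalar -/(dot x y) xy; apply/matrixP => i j; rewrite !mxE mul0rn.
set M := p^T *m p + (J0 p)^T *m J0 p.
have MM : M *m M = zsq p *: M.
  rewrite /M mulmxDl !mulmxDr !mulmxA -!(mulmxA _ p) -!(mulmxA _ (J0 p)).
  rewrite !sq !s0 ?dot_p_J0p ?dot_J0_diag // dot_J0p_J0p -zsqE.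
  by rewrite !mulmx0 !mul0mx addr0 add0r !mul_mx_scalar -!scalemxAl scalerDr.
have inv : rot_mx f b p *m rot_mx f^-1 c p = 1%:M.
  rewrite /rot_mx -/M mulmxDl !mulmxDr -scalar_mxM divff //.
  rewrite mul_scalar_mx mul_mx_scalar -scalemxAl -scalemxAr MM !scalerA -addrA.
  rewrite -!scalerDl; set k := (X in X *: M).
  have -> : k = 0 by rewrite /k /c; field; rewrite f0 e0.
  by rewrite scale0r addr0.
have [u1 _] := mulmx1_unit inv.
by rewrite -[RHS](mulKmx u1) inv mulmx1.
Qed.

(** Derivative of [rot_form f b p u v] along [w], where [f1] and [b1] are the
    derivatives of the two coefficients with respect to [zsq p]. *)
Definition drot_form (f1 b1 b : R) p w u v : R :=
  2 * dot p w * rot_form f1 b1 p u v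
  + b * (dot w u * dot p v + dot p u * dot w v
         + dot (J0 w) u * dot (J0 p) v + dot (J0 p) u * dot (J0 w) v).

Lemma is_derive_rot_form (f b : R -> R) (f1 b1 : R) p w u v :
  is_derive (zsq p) 1 f f1 -> is_derive (zsq p) 1 b b1 ->
  is_derive p w (fun q => rot_form (f (zsq q)) (b (zsq q)) q u v)
    (drot_form f1 b1 (b (zsq p)) p w u v).
Proof.
move=> df db.
have Df := is_derive_compose df (is_derive_zsq p w).
have Db := is_derive_compose db (is_derive_zsq p w).
have Dp := is_derive_dotl p _ w; have Dq := is_derive_dot_J0l p _ w.
apply: (is_derive_eq (is_derive_add (is_derive_mul Df (is_derive_const _ _ _))
  (is_derive_mul Db (is_derive_add (is_derive_mul (Dp u) (Dp v))
     (is_derive_mul (Dq u) (Dq v)))))).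
by rewrite /drot_form /rot_form (dotC p w); ring.
Qed.

(** The Christoffel symbols with lowered index, as a vector. *)
Definition christoffel_low (f1 b1 b : R) p u v : 'rV[R]_(n + n) :=
  (f1 * dot p u) *: v + (f1 * dot p v) *: u
  + (b - f1) * dot u v *: p
  + b1 * (dot p u * dot p v - dot (J0 p) u * dot (J0 p) v) *: p
  + b1 * (dot p u * dot (J0 p) v + dot p v * dot (J0 p) u) *: J0 p
  + (b * dot (J0 p) v) *: J0 u + (b * dot (J0 p) u) *: J0 v.

Lemma drot_form_cyc (f1 b1 b : R) p x u v :
  drot_form f1 b1 b p u x v + drot_form f1 b1 b p v x u - drot_form f1 b1 b p x u v
  = 2 * dot (christoffel_low f1 b1 b p u v) x.
Proof.
rewrite /drot_form /rot_form /christoffel_low !dotDl !dotZl.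
rewrite (dotC x u) (dotC x v) (dotC v u) (dot_swapJ0 x u) (dot_swapJ0 x v) (dot_swapJ0 v u).
by rewrite (dotC v x) (dotC u x) (dotC x u) (dotC x v); ring.
Qed.

(** A family of trilinear forms that contains the Christoffel symbols of
    [rot_mx]. Its contractions are polynomial in the coefficients, and are
    computed with free coefficients because those of [christoffel_form] are
    unwieldy. *)
Definition rot_tensor (A B D X Y Z : R) p x u v : R :=
  A * (dot p u * dot v x + dot p v * dot u x)
  + B * (dot p x * dot u v)
  + D * (dot (J0 p) v * dot (J0 u) x + dot (J0 p) u * dot (J0 v) x)
  + X * (dot p x * dot p u * dot p v)
  + Y * (dot p x * dot (J0 p) u * dot (J0 p) v)
  + Z * (dot (J0 p) x * (dot p u * dot (J0 p) v + dot p v * dot (J0 p) u)).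

Definition christoffel_form (f f1 b b1 : R) p x u v : R :=
  let e := f + zsq p * b in
  rot_tensor (f1 / f) ((b - f1) / e) (b / f)
    (b1 / e - 2 * f1 * b / (f * e))
    (2 * b ^+ 2 / (f * e) - b1 / e)
    (b1 / e - f1 * b / (f * e) - b ^+ 2 / (f * e)) p x u v.

Lemma christoffel_formE (f f1 b b1 : R) p x u v :
  f != 0 -> f + zsq p * b != 0 ->
  rot_form f^-1 (- b / (f * (f + zsq p * b))) p x (christoffel_low f1 b1 b p u v)
  = christoffel_form f f1 b b1 p x u v.
Proof.
move=> f0 e0.
rewrite /rot_form !(dotC _ (christoffel_low _ _ _ _ _ _)) /christoffel_low.
rewrite !dotDl !dotZl dot_p_J0p dot_J0_diag dot_J0p_J0p -zsqE.
rewrite !dot_J0J0 !(dot_J0r _ p) (dot_swapJ0 u p) (dot_swapJ0 v p).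
rewrite (dotC v p) (dotC u p).
rewrite /christoffel_form /rot_tensor.
by field; rewrite f0 e0.
Qed.

Section Contractions.
Variables (A B D X Y Z : R) (p : 'rV[R]_(n + n)).
Let T := rot_tensor A B D X Y Z p.
Let q := J0 p.

Lemma sum_const_basis (c : R) : \sum_(i < n + n) c = (n + n)%:R * c.
Proof. by rewrite sumr_const card_ord mulr_natl. Qed.

Lemma rot_tensorC x u v : T x u v = T x v u.
Proof. by rewrite /T /rot_tensor (dotC u v); ring. Qed.

Lemma rot_tensor_contract x y v : \sum_i dot y (e_ i) * T x (e_ i) v = T x y v.
Proof.
pose K := (A * dot v x) *: p + (A * dot p v) *: x + (B * dot p x) *: v
  + (- D * dot q v) *: J0 x + (D * dot (J0 v) x) *: q
  + (X * dot p x * dot p v) *: p + (Y * dot p x * dot q v) *: q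
  + (Z * dot q x * dot q v) *: p + (Z * dot q x * dot p v) *: q.
have TK u : T x u v = dot K u.
  rewrite /T /rot_tensor /K !dotDl !dotZl -/q (dot_swapJ0 u x) (dotC x u) (dotC v u).
  by ring.
by under eq_bigr do rewrite TK; rewrite sum_dot_basis dotC TK.
Qed.

Lemma rot_tensor_trace x :
  \sum_i T x (e_ i) (e_ i) = (2 * A + (n + n)%:R * B - 2 * D + zsq p * (X + Y)) * dot p x.
Proof.
rewrite (eq_bigr (fun i => 2 * A * (dot p (e_ i) * dot x (e_ i)) + B * dot p x
    + (- (2 * D)) * (dot q (e_ i) * dot (J0 x) (e_ i))
    + X * dot p x * (dot p (e_ i) * dot p (e_ i))
    + Y * dot p x * (dot q (e_ i) * dot q (e_ i))
    + 2 * Z * dot q x * (dot p (e_ i) * dot q (e_ i)))); last first.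
  move=> i _; rewrite /T /rot_tensor -/q dot_basis_diag (dot_swapJ0 (e_ i)).
  by rewrite ?(dotC (e_ i) x); ring.
rewrite !big_split /= -!mulr_sumr !sum_dot_basis sum_const_basis.
by rewrite /q dot_J0J0 dot_p_J0p dot_J0p_J0p -zsqE; ring.
Qed.

Lemma rot_tensor_trace_low v :
  \sum_i T (e_ i) (e_ i) v = (((n + n)%:R + 1) * A + B + D + zsq p * (X + Z)) * dot p v.
Proof.
rewrite (eq_bigr (fun i => (A + B) * (dot p (e_ i) * dot v (e_ i)) + A * dot p v
    + D * (dot q (e_ i) * dot (J0 v) (e_ i))
    + (X + 0) * dot p v * (dot p (e_ i) * dot p (e_ i))
    + (Y + Z) * dot q v * (dot p (e_ i) * dot q (e_ i))
    + Z * dot p v * (dot q (e_ i) * dot q (e_ i)))); last first.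
  move=> i _; rewrite /T /rot_tensor -/q dot_basis_diag dot_J0_diag.
  by rewrite (dotC (e_ i) v); ring.
rewrite !big_split /= -!mulr_sumr !sum_dot_basis sum_const_basis.
by rewrite /q dot_J0J0 dot_p_J0p dot_J0p_J0p -zsqE; ring.
Qed.

Lemma rot_tensor_pp x : T x p p = zsq p * (2 * A + B + zsq p * X) * dot p x.
Proof.
by rewrite /T /rot_tensor -zsqE dot_J0_diag; ring.
Qed.

Lemma rot_tensor_qq x : T x q q = zsq p * (B - 2 * D + zsq p * Y) * dot p x.
Proof.
by rewrite /T /rot_tensor /q dot_J0p_J0p dot_p_J0p J0K dotNl; ring.
Qed.

Lemma rot_tensor_trace_J :
  \sum_i T (e_ i) (J0 (e_ i)) q =
  zsq p * (B - A - ((n + n)%:R + 1) * D + zsq p * (Y - Z)).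
Proof.
rewrite (eq_bigr (fun i =>  (- A) * (dot q (e_ i) * dot q (e_ i))
    + B * (dot p (e_ i) * dot p (e_ i))
    + (- (D * zsq p))
    + (- D) * (dot p (e_ i) * dot p (e_ i))
    + Y * zsq p * (dot p (e_ i) * dot p (e_ i))
    + (- (Z * zsq p)) * (dot q (e_ i) * dot q (e_ i)))); last first.
  move=> i _; rewrite /T /rot_tensor /q dot_J0p_J0p dot_p_J0p !J0K !dotNl.
  rewrite !dot_J0J0 dot_basis_diag !(dot_J0r p) (dotC (e_ i) p).
  by ring.
rewrite !big_split /= -!mulr_sumr !sum_dot_basis !sum_const_basis.
by rewrite /q dot_J0p_J0p -zsqE; ring.
Qed.

End Contractions.

Lemma rot_tensor_raise (A B D X Y Z a c : R) p x w y :
  let T := rot_tensor A B D X Y Z p in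
  \sum_j T x w (e_ j) * rot_form a c p (e_ j) y =
  a * T x w y + c * (dot p y * T x w p + dot (J0 p) y * T x w (J0 p)).
Proof.
move=> T; have C u : \sum_j dot u (e_ j) * T x w (e_ j) = T x w u.
  under eq_bigr do rewrite /T rot_tensorC.
  by rewrite rot_tensor_contract rot_tensorC.
rewrite -(C y) -(C p) -(C (J0 p)) !mulr_sumr -big_split mulr_sumr -big_split.
apply: eq_bigr => j _ /=; rewrite /rot_form (dotC (e_ j) y); ring.
Qed.

Lemma rot_tensor_trace_rot (A B D X Y Z a c : R) p x :
  let T := rot_tensor A B D X Y Z p in
  \sum_j \sum_k rot_form a c p (e_ j) (e_ k) * T x (e_ j) (e_ k) =
  (a * (2 * A + (n + n)%:R * B - 2 * D + zsq p * (X + Y))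
   + c * zsq p * (2 * A + 2 * B - 2 * D + zsq p * (X + Y))) * dot p x.
Proof.
move=> T.
have -> : \sum_j \sum_k rot_form a c p (e_ j) (e_ k) * T x (e_ j) (e_ k) =
    \sum_j (a * T x (e_ j) (e_ j) + c * (dot p (e_ j) * T x (e_ j) p
       + dot (J0 p) (e_ j) * T x (e_ j) (J0 p))).
  apply: eq_bigr => j _; rewrite -rot_tensor_raise; apply: eq_bigr => k _.
  by rewrite /rot_form (dotC (e_ j) (e_ k)) -/T; ring.
transitivity (a * (\sum_j T x (e_ j) (e_ j)) + c * (\sum_j dot p (e_ j) * T x (e_ j) p)
    + c * (\sum_j dot (J0 p) (e_ j) * T x (e_ j) (J0 p))).
  by rewrite !mulr_sumr -!big_split; apply: eq_bigr => j _ /=; ring.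
rewrite /T rot_tensor_trace !rot_tensor_contract.
by rewrite rot_tensor_pp rot_tensor_qq; ring.
Qed.

(** The quadratic term of [scalar_curvature_divergence]. The derivative of the
    inverse metric consists of products of vectors, so only single traces of the
    Christoffel symbols occur. *)
Lemma rot_tensor_drot (A B D X Y Z a1 c1 c : R) p :
  let T := rot_tensor A B D X Y Z p in
  \sum_s \sum_i \sum_k drot_form a1 c1 c p (e_ s) (e_ i) (e_ k) * T (e_ s) (e_ i) (e_ k) =
  zsq p * (2 * a1 * (2 * A + (n + n)%:R * B - 2 * D + zsq p * (X + Y))
    + 2 * c1 * zsq p * (2 * A + 2 * B - 2 * D + zsq p * (X + Y))
    + 2 * c * (((n + n)%:R + 1) * A + B + D + zsq p * (X + Z))
    + 2 * c * (B - A - ((n + n)%:R + 1) * D + zsq p * (Y - Z))).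
Proof.
move=> T; set v := 2 * A + _ * B - _ + _; set v' := 2 * A + 2 * B - _ + _.
have inner_sum x w : \sum_i \sum_k drot_form a1 c1 c p w (e_ i) (e_ k) * T x (e_ i) (e_ k)
    = 2 * dot p w * ((a1 * v + c1 * zsq p * v') * dot p x)
      + 2 * c * (T x w p + T x (J0 w) (J0 p)).
  rewrite -(rot_tensor_trace_rot A B D X Y Z) -/T.
  have C2 u u' : \sum_i \sum_k dot u (e_ i) * dot u' (e_ k) * T x (e_ i) (e_ k) = T x u u'.
    rewrite -[RHS]rot_tensor_contract; apply: eq_bigr => i _.
    rewrite -/T /T rot_tensorC -[in RHS]rot_tensor_contract mulr_sumr.
    by apply: eq_bigr => k _; rewrite -mulrA rot_tensorC.
  have TC u u' : T x u u' = T x u' u by exact: rot_tensorC.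
  (* [drot_form] is symmetric in its last two arguments, as is [T]. *)
  rewrite (_ : T x w p + T x (J0 w) (J0 p) = 2^-1 * (T x w p + T x p w
     + T x (J0 w) (J0 p) + T x (J0 p) (J0 w))); last first.
    by rewrite (TC p) (TC (J0 p)); field.
  rewrite -!C2 -!big_split !mulr_sumr -big_split; apply: eq_bigr => i _ /=.
  rewrite -!big_split !mulr_sumr -big_split; apply: eq_bigr => k _ /=.
  by rewrite /drot_form; field.
transitivity (2 * (a1 * v + c1 * zsq p * v') * (\sum_s dot p (e_ s) * dot p (e_ s))
   + 2 * c * (\sum_s T (e_ s) (e_ s) p) + 2 * c * \sum_s T (e_ s) (J0 (e_ s)) (J0 p)).
  move: inner_sum; rewrite {}/v {}/v'; move: (zsq p) => z inner_sum.
  by rewrite !mulr_sumr -!big_split; apply: eq_bigr => s _ /=; rewrite inner_sum; ring.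
rewrite sum_dot_basis /T rot_tensor_trace_low rot_tensor_trace_J.
by rewrite -zsqE; ring.
Qed.

(** Covariant constancy of the metric, for the inverse matrix. *)
Lemma rot_form_parallel (f f1 b b1 : R) p w x y :
  f != 0 -> f + zsq p * b != 0 ->
  let e := f + zsq p * b in let e1 := f1 + b + zsq p * b1 in
  let a1 := - f ^- 2 * f1 in
  let c1 := - b1 / (f * e) + b * (f1 * e + f * e1) / (f * e) ^+ 2 in
  let c := - b / (f * e) in
  let T := christoffel_form f f1 b b1 p in
  drot_form a1 c1 c p w x y =
  - \sum_j (T x w (e_ j) * rot_form f^-1 c p (e_ j) y
            + T y w (e_ j) * rot_form f^-1 c p (e_ j) x).
Proof.
move=> f0 e0 e e1 a1 c1 c T; rewrite big_split /= !rot_tensor_raise.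
rewrite /drot_form /rot_form /rot_tensor dot_J0p_J0p dot_p_J0p dot_J0_diag -!zsqE.
rewrite !J0K !dotNl (dotC w (J0 p)) (dotC w p) (dotC y x) (dot_swapJ0 y x).
rewrite /c /c1 /a1 /e1 /e.
by field; rewrite f0 e0.
Qed.

End RotationalTensors.

Section TraceCoefficients.
Context {R : realType} (n : nat) (f f1 b b1 : R -> R).

(** The traces of the Christoffel symbols are radial; these are their
    coefficients. The first one is twice the logarithmic derivative of
    [f ^+ (n - 1) * (f + t * b)], the square root of the determinant of the
    metric; the second one measures the torsion [f1 - b], which vanishes exactly
    where the Kaehler form is closed. *)
Definition trace_low_coef t : R :=
  2 * ((f1 t + b t + t * b1 t) / (f t + t * b t) + (n%:R - 1) * f1 t / f t).

Definition trace_up_coef t : R :=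
  - (2 * (n%:R - 1) * (f1 t - b t)) / ((f t + t * b t) * f t).

End TraceCoefficients.

Section ScalarCurvature.
Context {R : realType} {n : nat}.
Variables (I : set R) (f f1 f2 b b1 b2 : R -> R).
Hypotheses (oI : open I)
  (df : forall t, I t -> is_derive t 1 f (f1 t))
  (df1 : forall t, I t -> is_derive t 1 f1 (f2 t))
  (db : forall t, I t -> is_derive t 1 b (b1 t))
  (db1 : forall t, I t -> is_derive t 1 b1 (b2 t))
  (f0 : forall t, I t -> f t != 0) (e0 : forall t, I t -> f t + t * b t != 0).
Variable g : 'rV[R]_(n + n) -> 'M[R]_(n + n).
Let U : set 'rV[R]_(n + n) := (zsq @^-1` I)%classic.
Hypothesis gE : forall q, U q -> g q = rot_mx (f (zsq q)) (b (zsq q)) q.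
Local Notation e_ i := (std_basis i : 'rV[R]_(n + n)).

Let e t := f t + t * b t.
Let e1 t := f1 t + b t + t * b1 t.
Local Notation trace_low := (trace_low_coef n f f1 b b1).
Local Notation trace_up := (trace_up_coef n f f1 b).

Lemma nbhs_zsq q : U q -> \forall q' \near q, U q'.
Proof.
move=> Uq; apply: open_nbhs_nbhs; split=> //.
by apply: open_comp => // p _; exact: continuous_zsq.
Qed.

Lemma pd_metric q i j k : U q ->
  pd k (fun q => g q i j) q =
  drot_form (f1 (zsq q)) (b1 (zsq q)) (b (zsq q)) q (e_ k) (e_ i) (e_ j).
Proof.
move=> Uq; have [_ <-] := is_derive_rot_form (e_ k) (e_ i) (e_ j) (df Uq) (db Uq).
apply: near_eq_derive; apply: filterS (nbhs_zsq Uq) => q' Uq'.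
by rewrite gE // rot_mxE.
Qed.

Lemma invmx_metric q : U q ->
  invmx (g q) = rot_mx (f (zsq q))^-1 (- b (zsq q) / (f (zsq q) * e (zsq q))) q.
Proof. by move=> Uq; rewrite gE // invmx_rot_mx //; [exact: f0|exact: e0]. Qed.

Lemma christoffel_metric q i j k : U q -> christoffel g i j k q =
  christoffel_form (f (zsq q)) (f1 (zsq q)) (b (zsq q)) (b1 (zsq q)) q (e_ i) (e_ j) (e_ k).
Proof.
move=> Uq; rewrite /christoffel invmx_metric //.
under eq_bigr => l _.
  rewrite rot_mxE !pd_metric // drot_form_cyc.
  over.
rewrite -christoffel_formE ?f0 ?e0 //.
set v := christoffel_low _ _ _ _ _ _; rewrite /rot_form.
rewrite -[dot (e_ i) v]sum_dot_basis -[dot q v]sum_dot_basis -[dot (J0 q) v]sum_dot_basis.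
rewrite !mulr_sumr -big_split mulr_sumr -big_split; apply: eq_bigr => l _ /=.
by rewrite -/(e _); field; rewrite f0 // e0.
Qed.

Lemma christoffel_trace_up_metric q i : U q ->
  christoffel_trace_up g i q = trace_up (zsq q) * dot q (e_ i).
Proof.
move=> Uq; rewrite /christoffel_trace_up.
under eq_bigr => j _ do under eq_bigr => k _
  do rewrite invmx_metric // rot_mxE christoffel_metric //.
rewrite rot_tensor_trace_rot natrD; congr (_ * _).
have fq := f0 Uq; have eq0 := e0 Uq; rewrite /trace_up_coef /e.
by field; rewrite fq eq0.
Qed.

Lemma christoffel_trace_low_metric q k : U q ->
  christoffel_trace_low g k q = trace_low (zsq q) * dot q (e_ k).
Proof.
move=> Uq; rewrite /christoffel_trace_low.
under eq_bigr => i _ do rewrite christoffel_metric //.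
rewrite rot_tensor_trace_low natrD; congr (_ * _).
have fq := f0 Uq; have eq0 := e0 Uq; rewrite /trace_low_coef /e /e1.
by field; rewrite fq eq0.
Qed.

Lemma derivable_radial (h : R -> R) (h1 : R) (q v : 'rV[R]_(n + n)) :
  is_derive (zsq q) 1 h h1 -> derivable (fun q : 'rV[R]_(n + n) => h (zsq q)) q v.
Proof. by move=> dh; have [] := is_derive_compose dh (is_derive_zsq q v). Qed.

Lemma derivable_dotl q x v : derivable (fun q : 'rV[R]_(n + n) => dot q x) q v.
Proof. by have [] := is_derive_dotl q x v. Qed.

Lemma derivable_dot_J0l q x v : derivable (fun q : 'rV[R]_(n + n) => dot (J0 q) x) q v.
Proof. by have [] := is_derive_dot_J0l q x v. Qed.

Ltac derivable_leaf := lazymatch goal with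
  | |- derivable (fun q_ => @dot _ _ q_ ?x) ?p ?v => exact (@derivable_dotl p x v)
  | |- derivable (fun q_ => @dot _ _ (J0 q_) ?x) ?p ?v =>
      exact (@derivable_dot_J0l p x v)
  | |- derivable (fun q_ => ?h (zsq q_)) _ _ => match goal with
      | H : derivable (fun q_ => h (zsq q_)) _ _ |- _ => exact H end
  | |- derivable _ _ _ => match goal with H : derivable zsq _ _ |- _ => exact H end
  | |- _ => by rewrite ?mulf_neq0
  end.

Lemma derivable_christoffel q i j k v : U q -> derivable (christoffel g i j k) q v.
Proof.
move=> Uq; apply: (@near_eq_derivable _ _ _ (fun q => christoffel_form (f (zsq q))
    (f1 (zsq q)) (b (zsq q)) (b1 (zsq q)) q (e_ i) (e_ j) (e_ k))).
  by apply: filterS (nbhs_zsq Uq) => q' Uq'; rewrite christoffel_metric.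
have Df := derivable_radial (v := v) (df Uq).
have Df1 := derivable_radial (v := v) (df1 Uq).
have Db := derivable_radial (v := v) (db Uq).
have Db1 := derivable_radial (v := v) (db1 Uq).
have Dz : derivable zsq q v by have [] := is_derive_zsq q v.
have fq := f0 Uq; have eq0 := e0 Uq.
rewrite /christoffel_form /rot_tensor; derivable_expr.
all: derivable_leaf.
Qed.

Lemma pd_invmx_metric q i k s : U q ->
  pd s (fun q => invmx (g q) i k) q =
  - \sum_j (christoffel g i s j q * invmx (g q) j k
            + christoffel g k s j q * invmx (g q) j i).
Proof.
move=> Uq; have fq := f0 Uq; have eq0 := e0 Uq.
have De : is_derive (zsq q) 1 e (e1 (zsq q)).
  apply: (is_derive_eq (is_derive_add (df Uq) (is_derive_mul (is_derive_id _ _) (db Uq)))).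
  by rewrite /e1; ring.
have Da := is_derive_inv fq (df Uq).
have De' : is_derive (zsq q) 1 (fun t => - b t / (f t * e t))
   (- b1 (zsq q) / (f (zsq q) * e (zsq q))
    + b (zsq q) * (f1 (zsq q) * e (zsq q) + f (zsq q) * e1 (zsq q))
      / (f (zsq q) * e (zsq q)) ^+ 2).
  apply: (is_derive_eq (is_derive_mul (is_derive_opp (db Uq))
    (is_derive_inv _ (is_derive_mul (df Uq) De)))); first by rewrite mulf_neq0.
  by rewrite /e; field; rewrite fq eq0.
have [_ D] := is_derive_rot_form (e_ s) (e_ i) (e_ k) Da De'.
transitivity ('D_(e_ s) (fun q => rot_form (f (zsq q))^-1
    (- b (zsq q) / (f (zsq q) * e (zsq q))) q (e_ i) (e_ k)) q).
  apply: near_eq_derive; apply: filterS (nbhs_zsq Uq) => q' Uq'.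
  by rewrite invmx_metric // rot_mxE.
rewrite D rot_form_parallel //; congr (- _); apply: eq_bigr => j _.
by rewrite invmx_metric // !rot_mxE !christoffel_metric.
Qed.

Lemma derivable_invmx_metric q i k v : U q ->
  derivable (fun q => invmx (g q) i k) q v.
Proof.
move=> Uq; have fq := f0 Uq; have eq0 := e0 Uq.
apply: (@near_eq_derivable _ _ _ (fun q => rot_form (f (zsq q))^-1
    (- b (zsq q) / (f (zsq q) * e (zsq q))) q (e_ i) (e_ k))).
  by apply: filterS (nbhs_zsq Uq) => q' Uq'; rewrite invmx_metric // rot_mxE.
have Df := derivable_radial (v := v) (df Uq).
have Db := derivable_radial (v := v) (db Uq).
have Dz : derivable zsq q v by have [] := is_derive_zsq q v.
rewrite /rot_form /e; derivable_expr.
all: derivable_leaf.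
Qed.

(** Second derivatives of [b] enter only through [w1], in the part that is twice
    the Chern scalar curvature by [chern_scalar_curvature_metric]. The other terms
    are multiples of the torsion [f1 - b] and of its derivative. *)
Lemma scalar_curvature_metric q (w1 v1 : R) : U q ->
  is_derive (zsq q) 1 trace_low w1 -> is_derive (zsq q) 1 trace_up v1 ->
  let z := zsq q in
  scalar_curvature g q =
    2 * n%:R * trace_up z + 2 * z * v1
    - (trace_low z * (2 * (n%:R - 1) / f z + 2 / e z) + 2 * z * w1 / e z)
    + z * trace_low z * trace_up z
    - 2 * (n%:R - 1) * z * (f1 z - b z) ^+ 2 / (e z * f z ^+ 2).
Proof.
move=> Uq Dw Dv z; have fq := f0 Uq; have eq0 := e0 Uq.
rewrite scalar_curvature_divergence; first last.
- by move=> s i k; exact: pd_invmx_metric.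
- by move=> i j k; rewrite !christoffel_metric // /christoffel_form rot_tensorC.
- by move=> i j l; exact: derivable_invmx_metric.
- by move=> i j k l; exact: derivable_christoffel.
have divV : \sum_i pd i (christoffel_trace_up g i) q =
    2 * n%:R * trace_up z + 2 * z * v1.
  have D i : pd i (christoffel_trace_up g i) q =
      2 * v1 * (dot q (e_ i) * dot q (e_ i)) + trace_up z.
    have [_ D] := is_derive_mul (is_derive_compose Dv (is_derive_zsq q (e_ i)))
      (is_derive_dotl q (e_ i) (e_ i)).
    transitivity ('D_(e_ i) (fun q => trace_up (zsq q) * dot q (e_ i)) q).
      apply: near_eq_derive; apply: filterS (nbhs_zsq Uq) => q' Uq'.
      by rewrite christoffel_trace_up_metric.
    by rewrite D dot_basis_diag /z; ring.
  rewrite (eq_bigr _ (fun i _ => D i)) big_split /= -mulr_sumr sum_dot_basis.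
  by rewrite sum_const_basis -zsqE natrD -/z; ring.
have lapW : \sum_j \sum_k invmx (g q) j k * pd j (christoffel_trace_low g k) q =
    trace_low z * (2 * (n%:R - 1) / f z + 2 / e z) + 2 * z * w1 / e z.
  have D j k : pd j (christoffel_trace_low g k) q =
      2 * w1 * (dot q (e_ j) * dot q (e_ k)) + trace_low z * dot (e_ j) (e_ k).
    have [_ D] := is_derive_mul (is_derive_compose Dw (is_derive_zsq q (e_ j)))
      (is_derive_dotl q (e_ k) (e_ j)).
    transitivity ('D_(e_ j) (fun q => trace_low (zsq q) * dot q (e_ k)) q).
      apply: near_eq_derive; apply: filterS (nbhs_zsq Uq) => q' Uq'.
      by rewrite christoffel_trace_low_metric.
    by rewrite D /z; ring.
  set a := (f z)^-1; set c := - b z / (f z * e z).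
  (* [r] is the j-th row of the inverse metric. *)
  have row j : \sum_k invmx (g q) j k * pd j (christoffel_trace_low g k) q =
      (2 * w1 * (a + c * z) + trace_low z * c) * (dot q (e_ j) * dot q (e_ j))
      + trace_low z * c * (dot (J0 q) (e_ j) * dot (J0 q) (e_ j))
      + trace_low z * a.
    pose r := a *: e_ j + (c * dot q (e_ j)) *: q + (c * dot (J0 q) (e_ j)) *: J0 q.
    transitivity (\sum_k (2 * w1 * dot q (e_ j) * (dot r (e_ k) * dot q (e_ k))
        + trace_low z * (dot r (e_ k) * dot (e_ j) (e_ k)))).
      apply: eq_bigr => k _; rewrite D invmx_metric // rot_mxE /r !dotDl !dotZl.
      by rewrite /rot_form -/z -/a -/c; ring.
    rewrite big_split /= -!mulr_sumr !sum_dot_basis /r !dotDl !dotZl.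
    by rewrite dot_J0_diag dot_basis_diag (dotC (e_ j) q) -zsqE -/z; ring.
  rewrite (eq_bigr _ (fun j _ => row j)) !big_split /= -!mulr_sumr !sum_dot_basis.
  rewrite sum_const_basis dot_J0p_J0p -zsqE natrD -/z /a /c /e.
  by field; rewrite fq eq0.
have WV : \sum_s christoffel_trace_low g s q * christoffel_trace_up g s q =
    z * trace_low z * trace_up z.
  transitivity (\sum_s trace_low z * trace_up z * (dot q (e_ s) * dot q (e_ s))).
    apply: eq_bigr => s _.
    by rewrite christoffel_trace_low_metric // christoffel_trace_up_metric // -/z; ring.
  by rewrite -mulr_sumr sum_dot_basis -zsqE -/z; ring.
have Qd : \sum_s \sum_i \sum_k
    pd s (fun q => invmx (g q) i k) q * christoffel g s i k q =
    4 * (n%:R - 1) * z * (f1 z - b z) ^+ 2 / (e z * f z ^+ 2).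
  transitivity (\sum_s \sum_i \sum_k drot_form (- f z ^- 2 * f1 z)
    (- b1 z / (f z * e z) + b z * (f1 z * e z + f z * e1 z) / (f z * e z) ^+ 2)
    (- b z / (f z * e z)) q (e_ s) (e_ i) (e_ k)
    * christoffel_form (f z) (f1 z) (b z) (b1 z) q (e_ s) (e_ i) (e_ k)).
    apply: eq_bigr => s _; apply: eq_bigr => i _; apply: eq_bigr => k _.
    rewrite pd_invmx_metric // christoffel_metric // /e /e1 rot_form_parallel //.
    congr (- _ * _); apply: eq_bigr => j _.
    by rewrite invmx_metric // !rot_mxE !christoffel_metric.
  rewrite rot_tensor_drot natrD /e /e1 -/z.
  by field; rewrite fq eq0.
rewrite divV lapW WV Qd /e.
by field; rewrite fq eq0.
Qed.

End ScalarCurvature.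

(** * Chern scalar curvature *)

(** Both sides are the determinant of the block matrix with rows [1, v] and
    [- u, 1], eliminated in the two possible orders. *)
Lemma det_add_rank1 {K : fieldType} m (u : 'cV[K]_m) (v : 'rV[K]_m) :
  \det (1%:M + u *m v) = 1 + (v *m u) 0 0.
Proof.
pose P : 'M[K]_(1 + m) := block_mx 1%:M v (- u) 1%:M.
have E1 : P = block_mx 1%:M 0 (- u) 1%:M *m block_mx 1%:M v 0 (1%:M + u *m v).
  rewrite mulmx_block !mul1mx !mul0mx !mulmx1 !addr0 mulNmx.
  by rewrite addrCA addNr addr0.
have E2 : P = block_mx 1%:M v 0 1%:M *m block_mx (1%:M + v *m u) 0 (- u) 1%:M.
  by rewrite mulmx_block !mul1mx !mul0mx !mulmx1 mulmxN !add0r addrK.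
have : \det P = \det P by [].
rewrite {1}E1 E2 !det_mulmx !det_lblock !det_ublock !det1 !mul1r mulr1 => ->.
by rewrite det_mx11 !mxE eqxx.
Qed.

Lemma det_scalar_add_rank1 {K : fieldType} m (a c : K) (u : 'cV[K]_m) (v : 'rV[K]_m) :
  (0 < m)%N -> a != 0 ->
  \det (a%:M + c *: (u *m v)) = a ^+ m.-1 * (a + c * (v *m u) 0 0).
Proof.
case: m u v => // m u v _ a0.
have -> : a%:M + c *: (u *m v) = a *: (1%:M + ((c / a) *: u) *m v).
  by rewrite scalerDr -scalemxAl scalerA scale_scalar_mx mulr1 mulrCA divff ?mulr1.
rewrite detZ det_add_rank1 -scalemxAr [in X in _ * (1 + X)]mxE exprSr -mulrA.
by congr (_ * _); field.
Qed.

Lemma mulmx_conj_expand {K : comNzRingType} m (M : 'M[K]_m) (h k : K)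
    (a c a' c' : 'rV[K]_m) : k * k = -1 ->
  ((h *: (a - k *: c)) *m M *m (h *: (a' + k *: c'))^T) 0 0 =
  h * h * ((a *m M *m a'^T) 0 0 + k * (a *m M *m c'^T) 0 0
           - k * (c *m M *m a'^T) 0 0 + (c *m M *m c'^T) 0 0).
Proof.
move=> kk; pose s (x y : 'rV[K]_m) : K := (x *m M *m y^T) 0 0.
have sD x y z : s (x + y) z = s x z + s y z by rewrite /s !mulmxDl mxE.
have sZ r x z : s (r *: x) z = r * s x z by rewrite /s -!scalemxAl mxE.
have Ds x y z : s z (x + y) = s z x + s z y by rewrite /s linearD /= mulmxDr mxE.
have Zs r x z : s z (r *: x) = r * s z x by rewrite /s linearZ /= -scalemxAr mxE.
rewrite -[LHS]/(s _ _) -!/(s _ _) -scaleNr !(sZ, sD, Zs, Ds).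
transitivity (h * h * (s a a' + k * s a c' - k * s c a' - (k * k) * s c c')).
  by ring.
by rewrite kk; ring.
Qed.

Section ChernCurvature.
Context {R : realType} {n : nat}.
Local Open Scope complex_scope.
Variables (I : set R) (f f1 b b1 : R -> R).
Hypotheses (oI : open I) (n_gt0 : (0 < n)%N)
  (df : forall t, I t -> is_derive t 1 f (f1 t))
  (db : forall t, I t -> is_derive t 1 b (b1 t))
  (f_gt0 : forall t, I t -> 0 < f t) (e_gt0 : forall t, I t -> 0 < f t + t * b t).
Variable g : 'rV[R]_(n + n) -> 'M[R]_(n + n).
Let U : set 'rV[R]_(n + n) := (zsq @^-1` I)%classic.
Hypothesis gE : forall q, U q -> g q = rot_mx (f (zsq q)) (b (zsq q)) q.

Let e t := f t + t * b t.
Let e1 t := f1 t + b t + t * b1 t.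

Definition conj_col (q : 'rV[R]_(n + n)) : 'cV[R[i]]_n := \col_i conjc (toC q 0 i).

Lemma toC_conj_col q : (toC q *m conj_col q) 0 0 = (zsq q)%:C.
Proof.
rewrite mxE /zsq rmorph_sum; apply: eq_bigr => i _; rewrite !mxE.
by apply/eqP; rewrite eq_complex /=; apply/andP; split; apply/eqP; ring.
Qed.

Lemma half_complex : 2^-1 = (2^-1)%:C :> R[i].
Proof. by rewrite fmorphV rmorph_nat. Qed.

(** The factor [1 / 2] comes from the pairing of [d/dz] with [d/dzbar], which is
    half the Euclidean one. *)
Lemma herm_mxE q : U q -> herm_mx g q =
  (2^-1)%:C *: ((f (zsq q))%:C%:M + (b (zsq q))%:C *: (conj_col q *m toC q)).
Proof.
move=> Uq; apply/matrixP => i j; rewrite mxE gE //.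
set G := rot_mx _ _ _.
have E (u v : 'rV[R]_(n + n)) : (map_mx (real_complex R) u *m
    map_mx (real_complex R) G *m (map_mx (real_complex R) v)^T) 0 0
    = (rot_form (f (zsq q)) (b (zsq q)) q u v)%:C.
  by rewrite map_trmx -!map_mxM mxE inner_rot_mx.
have B (u v u' v' : 'rV[R]_(n + n)) :
    ((2^-1 *: (map_mx (real_complex R) u - 'i *: map_mx (real_complex R) v))
     *m map_mx (real_complex R) G
     *m (2^-1 *: (map_mx (real_complex R) u' + 'i *: map_mx (real_complex R) v'))^T) 0 0
    = 2^-1 * 2^-1 * ((rot_form (f (zsq q)) (b (zsq q)) q u u')%:C
       + 'i * (rot_form (f (zsq q)) (b (zsq q)) q u v')%:C
       - 'i * (rot_form (f (zsq q)) (b (zsq q)) q v u')%:C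
       + (rot_form (f (zsq q)) (b (zsq q)) q v v')%:C).
  by rewrite -!E; apply: mulmx_conj_expand; rewrite -expr2 sqrCi.
rewrite /vz /vzbar B.
have Dx p i' : dot p (e_x i') = lsubmx p 0 i' by rewrite dot_basis mxE.
have Dy p i' : dot p (e_y i') = rsubmx p 0 i' by rewrite dot_basis mxE.
have Jx p : lsubmx (J0 p) = - rsubmx p :> 'rV[R]_n by rewrite row_mxKl.
have Jy p : rsubmx (J0 p) = lsubmx p :> 'rV[R]_n by rewrite row_mxKr.
have Dxx : dot (e_x i : 'rV[R]_(n + n)) (e_x j) = (i == j)%:R.
  by rewrite dot_basis_basis eq_lshift.
have Dyy : dot (e_y i : 'rV[R]_(n + n)) (e_y j) = (i == j)%:R.
  by rewrite dot_basis_basis eq_rshift.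
have Dxy : dot (e_x i : 'rV[R]_(n + n)) (e_y j) = 0.
  by rewrite dot_basis_basis eq_lrshift.
have Dyx : dot (e_y i : 'rV[R]_(n + n)) (e_x j) = 0.
  by rewrite dot_basis_basis eq_rlshift.
rewrite /rot_form Dxx Dxy Dyx Dyy !Dx !Dy !Jx !Jy half_complex -complexiE.
rewrite !mxE big_ord1 !mxE.
have -> : (f (zsq q))%:C *+ (i == j) = (f (zsq q) * (i == j)%:R)%:C.
  by rewrite mulr_natr rmorphMn.
move: (f _) (b _) ((i == j)%:R) (q 0 (lshift n i)) (q 0 (lshift n j)).
move: (q 0 (rshift n i)) (q 0 (rshift n j)) => yi yj F B' d xi xj.
by apply/eqP; rewrite eq_complex /=; apply/andP; split; apply/eqP; field.
Qed.

Lemma det_herm_mx q : U q ->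
  \det (herm_mx g q) = (2^-1 ^+ n * (f (zsq q) ^+ n.-1 * e (zsq q)))%:C.
Proof.
move=> Uq; rewrite herm_mxE // detZ det_scalar_add_rank1 //; last first.
  by rewrite (fmorph_eq0 (real_complex R)) gt_eqF ?f_gt0.
rewrite toC_conj_col -rmorphM -rmorphD -!rmorphXn -!rmorphM /=.
by rewrite /e [zsq q * _]mulrC.
Qed.

Lemma is_derive_log_density t : I t ->
  is_derive t 1 (fun t => ln (2^-1 ^+ n * (f t ^+ n.-1 * e t)))
    (2^-1 * trace_low_coef n f f1 b b1 t).
Proof.
move=> It; have ft := f_gt0 It; have et := e_gt0 It.
have De : is_derive t 1 e (e1 t).
  apply: (is_derive_eq (is_derive_add (df It) (is_derive_mul (is_derive_id _ _) (db It)))).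
  by rewrite /e1; ring.
have Df : is_derive t 1 (fun t => f t ^+ n.-1) (n.-1%:R * f t ^+ n.-2 * f1 t).
  exact: is_derive_exp (df It).
have D := is_derive_mul (is_derive_const (2^-1 ^+ n) _ _) (is_derive_mul Df De).
have pos : 0 < 2^-1 ^+ n * (f t ^+ n.-1 * e t).
  by rewrite !mulr_gt0 ?exprn_gt0 ?invr_gt0.
have DC := @is_derive_compose _ _ (@ln R) _ t 1 _ _ (is_derive1_ln pos) D.
apply: (is_derive_eq DC).
rewrite /trace_low_coef -/(e t) -/(e1 t).
have f0 : f t != 0 by rewrite gt_eqF.
have e0 : e t != 0 by rewrite gt_eqF.
have nE : n%:R - 1 = n.-1%:R :> R by rewrite -subn1 natrB.
rewrite nE.
have h0 : (2^-1 : R) ^+ n != 0 by rewrite expf_neq0 // invr_neq0.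
have p0 : f t ^+ n.-1 != 0 by rewrite expf_neq0.
case: (n.-1) p0 => [|k] p0.
  by rewrite expr0 in p0 *; field; rewrite e0 f0 h0.
rewrite [k.+1.-1]/= exprS; field; rewrite e0 f0 h0 expf_neq0 //.
Qed.

(** The logarithm of the volume density is a function of [zsq], with derivative
    [trace_low_coef / 2], so its complex Hessian is the sum of a multiple of the
    identity and a rank-one matrix, like the metric itself. *)
Lemma chern_form_metric q i j (w1 : R) : U q ->
  is_derive (zsq q) 1 (trace_low_coef n f f1 b b1) w1 ->
  chern_form g i j q =
  - ((2^-1)%:C * ((trace_low_coef n f f1 b b1 (zsq q))%:C * (i == j)%:R
                  + w1%:C * (conj_col q i 0 * toC q 0 j))).
Proof.
move=> Uq Dw; set w := trace_low_coef n f f1 b b1.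
pose psi (q : 'rV[R]_(n + n)) := ln (complex.Re (\det (herm_mx g q))).
have Dpsi q' v : U q' -> 'D_v psi q' = w (zsq q') * dot q' v.
  move=> Uq'.
  have [_ D] := is_derive_compose (is_derive_log_density Uq') (is_derive_zsq q' v).
  transitivity ('D_v (fun q => ln (2^-1 ^+ n * (f (zsq q) ^+ n.-1 * e (zsq q)))) q').
    apply: near_eq_derive; apply: filterS (nbhs_zsq oI Uq') => q'' Uq''.
    by rewrite /psi det_herm_mx.
  by rewrite D (dotC q' v) /w; field.
have E q' : U q' -> dzbar j (fun q => (psi q)%:C) q' = (2^-1)%:C * ((w (zsq q'))%:C * toC q' 0 j).
  move=> Uq'; rewrite /dzbar /dC /= !Dpsi // !derive_cst half_complex -complexiE.
  rewrite !dot_basis !mxE.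
  by apply/eqP; rewrite eq_complex /=; apply/andP; split; apply/eqP; ring.
pose G := dzbar j (fun q => (psi q)%:C).
have DG (k : 'I_(n + n)) (h : R[i] -> R) v :
    (forall q' : 'rV[R]_(n + n),
       h ((2^-1)%:C * ((w (zsq q'))%:C * toC q' 0 j)) = 2^-1 * (w (zsq q') * q' 0 k)) ->
    'D_v (fun q => h (G q)) q = 2^-1 * (2 * w1 * dot q v * q 0 k + w (zsq q) * v 0 k).
  move=> hE.
  have D := is_derive_mul (is_derive_const (2^-1) q v)
    (is_derive_mul (is_derive_compose Dw (is_derive_zsq q v)) (is_derive_coord q v k)).
  transitivity ('D_v (fun q => 2^-1 * (w (zsq q) * q 0 k)) q).
    apply: near_eq_derive; apply: filterS (nbhs_zsq oI Uq) => q' Uq'.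
    by rewrite /G E // hE.
  by have [_ ->] := D; rewrite -/w; ring.
have DRe v := DG (lshift n j) (@complex.Re R) v.
have DIm v := DG (rshift n j) (@complex.Im R) v.
rewrite /chern_form; congr (- _); rewrite /dz -/psi -/G /dC.
rewrite !DRe; last 2 first.
- by move=> q'; rewrite !mxE /=; ring.
- by move=> q'; rewrite !mxE /=; ring.
rewrite !DIm; last 2 first.
- by move=> q'; rewrite !mxE /=; ring.
- by move=> q'; rewrite !mxE /=; ring.
rewrite half_complex -complexiE /e_x /e_y !dot_basis !mxE !eqxx /=.
rewrite eq_lshift eq_rshift eq_lrshift eq_rlshift.
rewrite (eq_sym j i); have -> : (i == j)%:R = ((i == j)%:R)%:C :> R[i].
  by rewrite rmorph_nat.
move: (w _) ((i == j)%:R) (q 0 (lshift n i)) (q 0 (lshift n j)).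
move: (q 0 (rshift n i)) (q 0 (rshift n j)) => yi yj W d xi xj.
by apply/eqP; rewrite eq_complex /=; apply/andP; split; apply/eqP; field.
Qed.

Lemma invmx_herm_mx q : U q -> invmx (herm_mx g q) =
  2%:C *: (((f (zsq q))^-1)%:C%:M
           + (- b (zsq q) / (f (zsq q) * e (zsq q)))%:C *: (conj_col q *m toC q)).
Proof.
move=> Uq; have f0 : f (zsq q) != 0 by rewrite gt_eqF ?f_gt0.
have e0 : e (zsq q) != 0 by rewrite gt_eqF ?e_gt0.
set c := - b _ / _; set M := conj_col q *m toC q.
have MM : M *m M = (zsq q)%:C *: M.
  rewrite /M mulmxA -(mulmxA (conj_col q)) [toC q *m _]mx11_scalar toC_conj_col.
  by rewrite mul_mx_scalar scalemxAl.
have inv : herm_mx g q *m (2%:C *: (((f (zsq q))^-1)%:C%:M + c%:C *: M)) = 1%:M.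
  rewrite herm_mxE // -/M -scalemxAl -scalemxAr scalerA -rmorphM /= mulVf //.
  rewrite scale1r mulmxDl !mulmxDr -scalar_mxM -rmorphM /= divff //.
  rewrite mul_scalar_mx mul_mx_scalar -scalemxAl -scalemxAr MM !scalerA -addrA.
  rewrite -!scalerDl -!rmorphM -!rmorphD /=; set k := (X in X%:C *: M).
  have -> : k = 0 by rewrite /k /c /e; field; rewrite f0 andbT; exact: e0.
  by rewrite (_ : 0%:C = 0) // scale0r addr0.
have [u1 _] := mulmx1_unit inv.
by rewrite -[RHS](mulKmx u1) inv mulmx1.
Qed.

Lemma chern_scalar_curvature_metric q (w1 : R) : U q ->
  is_derive (zsq q) 1 (trace_low_coef n f f1 b b1) w1 ->
  let z := zsq q in
  2 * chern_scalar_curvature g q =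
  (- (trace_low_coef n f f1 b b1 z * (2 * (n%:R - 1) / f z + 2 / e z)
      + 2 * z * w1 / e z))%:C.
Proof.
move=> Uq Dw z; set w := trace_low_coef _ _ _ _ _ z.
have f0 : f z != 0 by rewrite gt_eqF ?f_gt0.
have e0 : e z != 0 by rewrite gt_eqF ?e_gt0.
set a := (f z)^-1; set c := - b z / (f z * e z).
have zz : \sum_i conj_col q i 0 * toC q 0 i = z%:C.
  by rewrite -toC_conj_col mxE; apply: eq_bigr => i _; rewrite mulrC.
have row i : \sum_j invmx (herm_mx g q) j i * chern_form g i j q =
    - (w * a)%:C - (w * c + w1 * (a + c * z))%:C * (conj_col q i 0 * toC q 0 i).
  pose u := conj_col q i 0; pose v := toC q 0 i.
  have rM (x y : R) : (x * y)%:C = x%:C * y%:C :> R[i] by exact: rmorphM.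
  have rD (x y : R) : (x + y)%:C = x%:C + y%:C :> R[i] by exact: rmorphD.
  have delta (h : 'I_n -> R[i]) : \sum_j (i == j)%:R * h j = h i.
    rewrite (bigD1 i) //= eqxx mul1r big1 ?addr0 // => j ji.
    by rewrite eq_sym (negbTE ji) mul0r.
  transitivity (- (w * a)%:C * (\sum_j (i == j)%:R * 1)
      - (w * c)%:C * v * (\sum_j (i == j)%:R * conj_col q j 0)
      - (w1 * a)%:C * u * (\sum_j (i == j)%:R * toC q 0 j)
      - (w1 * c)%:C * (u * v) * (\sum_j conj_col q j 0 * toC q 0 j)).
    rewrite !mulr_sumr -!sumrB; apply: eq_bigr => j _.
    rewrite invmx_herm_mx // (chern_form_metric _ _ Uq Dw) -/w -/z -/a -/c -/u.
    have M1 : (conj_col q *m toC q) j i = conj_col q j 0 * v by rewrite mxE big_ord1.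
    have -> : (2%:C *: (a%:C%:M + c%:C *: (conj_col q *m toC q))) j i =
        2%:C * (a%:C * (i == j)%:R + c%:C * (conj_col q j 0 * v)).
      rewrite [LHS]mxE [X in _ * X = _]mxE [X in _ * (_ + X) = _]mxE M1.
      by rewrite [X in _ * (X + _) = _]mxE eq_sym mulr_natr.
    have -> : (2%:C * (a%:C * (i == j)%:R + c%:C * (conj_col q j 0 * v)) *
       - ((2^-1)%:C * (w%:C * (i == j)%:R + w1%:C * (u * toC q 0 j)))) =
       - (2%:C * (2^-1)%:C) * ((a%:C * (i == j)%:R + c%:C * (conj_col q j 0 * v)) *
       (w%:C * (i == j)%:R + w1%:C * (u * toC q 0 j))) by ring.
    rewrite -rM divff // rmorph1 (rM w a) (rM w c) (rM w1 a) (rM w1 c).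
    by case: (i == j) => /=; rewrite ?mulr1n ?mulr0n; ring.
  rewrite !delta zz (rD (w * c)) (rM w1 (a + c * z)) (rD a) (rM c z) (rM w a) (rM w c).
  rewrite (rM w1 a) (rM w1 c) -/u -/v; ring.
rewrite /chern_scalar_curvature (eq_bigr _ (fun i _ => row i)).
rewrite big_split /= !sumrN sumr_const card_ord -mulr_sumr zz -[_ *+ n]mulr_natr.
have -> : n%:R = (n%:R)%:C :> R[i] by rewrite rmorph_nat.
have -> : 2 = 2%:C :> R[i] by rewrite rmorph_nat.
transitivity (- (2 * (w * a * n%:R + (w * c + w1 * (a + c * z)) * z)))%:C.
  by apply/eqP; rewrite eq_complex /=; apply/andP; split; apply/eqP; ring.
by congr (_%:C); rewrite /a /c /e; field; rewrite f0 ?andbT; exact: e0.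
Qed.

End ChernCurvature.

(** * The Klsc equation and the Kaehler condition *)

Section KlscEquation.
Context {R : realType} {n : nat}.
Local Open Scope complex_scope.
Variables (I : set R) (f f1 f2 b b1 b2 : R -> R).
Hypotheses (oI : open I) (n_ge2 : (2 <= n)%N)
  (I_gt0 : forall t, I t -> 0 < t)
  (df : forall t, I t -> is_derive t 1 f (f1 t))
  (df1 : forall t, I t -> is_derive t 1 f1 (f2 t))
  (db : forall t, I t -> is_derive t 1 b (b1 t))
  (db1 : forall t, I t -> is_derive t 1 b1 (b2 t))
  (f_gt0 : forall t, I t -> 0 < f t) (e_gt0 : forall t, I t -> 0 < f t + t * b t).
Variable g : 'rV[R]_(n + n) -> 'M[R]_(n + n).
Let U : set 'rV[R]_(n + n) := (zsq @^-1` I)%classic.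
Hypothesis gE : forall q, U q -> g q = rot_mx (f (zsq q)) (b (zsq q)) q.

Let i0 : 'I_n := Ordinal (ltnW n_ge2).
Let i1 : 'I_n := Ordinal n_ge2.

Definition ray_point (t : R) : 'rV[R]_(n + n) := Num.sqrt t *: e_x i0.

Lemma dot_e_x (i j : 'I_n) : dot (e_x i : 'rV[R]_(n + n)) (e_x j) = (i == j)%:R.
Proof. by rewrite dot_basis_basis eq_lshift. Qed.

Lemma J0_e_x (i : 'I_n) : J0 (e_x i) = e_y i :> 'rV[R]_(n + n).
Proof.
by rewrite /e_x /e_y /std_basis delta_mx_lshift /J0 row_mxKl row_mxKr oppr0
   -delta_mx_rshift.
Qed.

Lemma zsq_ray_point t : 0 <= t -> zsq (ray_point t) = t.
Proof.
move=> t0; rewrite zsqE /ray_point dotZl dotZr dot_e_x eqxx mulr1 -expr2.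
exact: sqr_sqrtr.
Qed.

(** In [S - 2 S_C] the terms with second derivatives of the volume density
    cancel, which leaves a first-order equation for the torsion [f1 - b]. *)
Lemma klsc_ode : klsc U g <-> forall t, I t ->
  n%:R * (f1 t - b t) + t * (f2 t - b1 t)
  + (n%:R - 2) * t * (f1 t - b t) * f1 t / f t
  + t * (f1 t - b t) ^+ 2 / (2 * f t) = 0.
Proof.
have f0 t : I t -> f t != 0 by move=> It; rewrite gt_eqF ?f_gt0.
have e0 t : I t -> f t + t * b t != 0 by move=> It; rewrite gt_eqF ?e_gt0.
have n0 : (n%:R - 1 : R) != 0.
  by rewrite subr_eq0 pnatr_eq1 gtn_eqF.
have E q : U q -> scalar_curvature g q =
    - (4 * (n%:R - 1)) / ((f (zsq q) + zsq q * b (zsq q)) * f (zsq q)) *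
    (n%:R * (f1 (zsq q) - b (zsq q)) + zsq q * (f2 (zsq q) - b1 (zsq q))
    + (n%:R - 2) * zsq q * (f1 (zsq q) - b (zsq q)) * f1 (zsq q) / f (zsq q)
    + zsq q * (f1 (zsq q) - b (zsq q)) ^+ 2 / (2 * f (zsq q)))
    + complex.Re (2 * chern_scalar_curvature g q)
    /\ complex.Im (2 * chern_scalar_curvature g q) = 0.
  move=> Uq; have fq := f0 _ Uq; have eq0 := e0 _ Uq.
  have Df := df Uq; have Df1 := df1 Uq; have Db := db Uq; have Db1 := db1 Uq.
  have De := is_derive_add Df (is_derive_mul (is_derive_id (zsq q) 1) Db).
  have De1 := is_derive_add (is_derive_add Df1 Db)
    (is_derive_mul (is_derive_id (zsq q) 1) Db1).
  have ef0 : (f (zsq q) + zsq q * b (zsq q)) * f (zsq q) != 0 by rewrite mulf_neq0.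
  have Dv := is_derive_mul (is_derive_opp (is_derive_mul
      (is_derive_const (2 * (n%:R - 1)) (zsq q) 1) (is_derive_sub Df1 Db)))
    (is_derive_inv (f := fun t => (f t + t * b t) * f t) ef0 (is_derive_mul De Df)).
  have Dw := is_derive_mul (is_derive_const 2 (zsq q) 1)
    (is_derive_add (is_derive_mul De1 (is_derive_inv (f := fun t => f t + t * b t) eq0 De))
      (is_derive_mul (is_derive_mul (is_derive_const (n%:R - 1) (zsq q) 1) Df1)
         (is_derive_inv (f := f) fq Df))).
  have -> := scalar_curvature_metric oI df df1 db db1 f0 e0 gE Uq Dw Dv.
  have -> := chern_scalar_curvature_metric oI (ltnW n_ge2) df db f_gt0 e_gt0 gE Uq Dw.
  split=> //=; rewrite /trace_low_coef /trace_up_coef.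
  by field; rewrite fq eq0.
have coef t : I t -> - (4 * (n%:R - 1)) / ((f t + t * b t) * f t) != 0.
  move=> It; have ft := f0 _ It; have et := e0 _ It.
  by rewrite mulf_neq0 ?invr_neq0 ?oppr_eq0 ?mulf_neq0 // pnatr_eq0.
split=> [K t It|ode q Uq].
  have tq : zsq (ray_point t) = t by rewrite zsq_ray_point // ltW ?I_gt0.
  have Uq : U (ray_point t) by rewrite /U /= tq.
  have [S _] := E _ Uq; have /(congr1 (@complex.Re R)) /= Kq := K _ Uq.
  move: S; rewrite Kq tq => /eqP; rewrite -subr_eq subrr eq_sym mulf_eq0.
  by rewrite (negbTE (coef t It)) => /eqP.
have [S Im0] := E _ Uq.
rewrite S (ode _ Uq) mulr0 add0r; apply/eqP; rewrite eq_complex /= eqxx /=.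
by rewrite [X in _ == X]Im0.
Qed.

(** The exterior derivative of the Kaehler form is [2 * (f1 - b)] times the wedge
    product of [d zsq / 2] with the standard Kaehler form, and that product does
    not vanish in complex dimension at least two. *)
Lemma kahler_rot : kahler U g <-> forall t, I t -> f1 t = b t.
Proof.
have E p u v w : U p -> 'D_u (fun q => kahler_form g q v w) p
    + 'D_v (fun q => kahler_form g q w u) p + 'D_w (fun q => kahler_form g q u v) p
    = 2 * (f1 (zsq p) - b (zsq p)) * (dot p u * dot (J0 v) w + dot p v * dot (J0 w) u
        + dot p w * dot (J0 u) v).
  move=> Up.
  have D x y z : 'D_x (fun q => kahler_form g q y z) p =
      drot_form (f1 (zsq p)) (b1 (zsq p)) (b (zsq p)) p x (J0 y) z.
    have [_ <-] := is_derive_rot_form x (J0 y) z (df Up) (db Up).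
    apply: near_eq_derive; apply: filterS (nbhs_zsq oI Up) => q Uq.
    by rewrite /kahler_form /inner gE // inner_rot_mx.
  rewrite !D /drot_form /rot_form !dot_J0J0 !(dot_J0r p).
  rewrite !(dot_J0r u) !(dot_J0r v) !(dot_J0r w).
  rewrite (dotC v u) (dotC w u) (dotC w v) (dot_swapJ0 v u) (dot_swapJ0 w u) (dot_swapJ0 w v).
  by ring.
split=> [K t It|h p u v w Up]; last by rewrite E // h // subrr mulr0 mul0r.
pose p := ray_point t.
have tp : zsq p = t by rewrite zsq_ray_point // ltW ?I_gt0.
have Up : U p by rewrite /U /= tp.
have := K p p (e_x i1) (J0 (e_x i1)) Up; rewrite E // tp -zsqE tp.
have -> : dot p (e_x i1) = 0 by rewrite /p dotZl dot_e_x mulr0.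
have -> : dot p (J0 (e_x i1)) = 0.
  by rewrite J0_e_x /p dotZl dot_basis_basis eq_lrshift mulr0.
rewrite dot_J0J0 dot_e_x eqxx !mul0r !addr0 mulr1 => /eqP.
rewrite !mulf_eq0 pnatr_eq0 /= (gt_eqF (I_gt0 It)) orbF subr_eq0.
by move=> /eqP.
Qed.

End KlscEquation.

(** * U(n)-invariant Hermitian metrics *)

Section UnitaryMaps.
Context {R : realType} {n : nat}.
Local Open Scope complex_scope.
Implicit Types (p u v w x : 'rV[R]_(n + n)).

Lemma toCD u v : toC (u + v) = toC u + toC v.
Proof. by apply/rowP => i; rewrite !mxE; apply/eqP; rewrite eq_complex /= !eqxx. Qed.

Lemma toCZ (c : R) u : toC (c *: u) = c%:C *: toC u.
Proof.
apply/rowP => i; rewrite !mxE.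
by apply/eqP; rewrite eq_complex /=; apply/andP; split; apply/eqP; ring.
Qed.

Lemma J00 : J0 0 = 0 :> 'rV[R]_(n + n).
Proof. by rewrite -[X in J0 X](scale0r 0) J0Z scale0r. Qed.

Lemma toC_inj : injective (@toC R n).
Proof. exact: can_inj toCK. Qed.

Lemma toC_e_x (i : 'I_n) : toC (e_x i) = delta_mx 0 i :> 'rV[R[i]]_n.
Proof.
apply/rowP => k; rewrite !mxE !eqxx /= eq_lshift eq_rlshift.
by case: (k == i); apply/eqP; rewrite eq_complex /= !eqxx.
Qed.

(** Complex linear maps are unitary as soon as they preserve the Euclidean
    product, so unitarity can be checked in real coordinates. *)
Lemma unitary_of_dot (A : 'M[R[i]]_n) :
  (forall u v, dot (cact A u) (cact A v) = dot u v) -> A \is unitarymx.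
Proof.
move=> dA; rewrite -trmx_unitary; apply/row_unitarymxP => i j.
rewrite !rowE -!toC_e_x -!toC_cact dotmx_toC J0_cact !dA.
rewrite dot_e_x J0_e_x dot_basis_basis eq_lrshift.
by case: (i == j); apply/eqP; rewrite eq_complex /= !eqxx.
Qed.

(** The complex reflection that is the identity on the Hermitian complement of
    [w] and maps [w] to [- w]; it is the identity for [w = 0]. *)
Definition reflection (w : 'rV[R]_(n + n)) : 'M[R[i]]_n :=
  (1%:M - (2 / dot w w)%:C *: (conj_col w *m toC w))^T.

Lemma toC_conj_col_dot v w :
  toC v *m conj_col w = (dot v w +i* dot v (J0 w))%:M.
Proof.
rewrite [LHS]mx11_scalar; congr (_%:M); rewrite -dotmx_toC dotmxE !mxE.
by apply: eq_bigr => i _; rewrite !mxE.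
Qed.

Lemma cact_reflection w v : cact (reflection w) v =
  v - (2 / dot w w) *: (dot v w *: w + dot v (J0 w) *: J0 w).
Proof.
apply: toC_inj; rewrite toC_cact /reflection trmxK mulmxBr mulmx1 -scalemxAr.
rewrite mulmxA toC_conj_col_dot mul_scalar_mx.
rewrite -[in RHS]scaleNr toCD toCZ toCD !toCZ toC_J0.
apply/rowP => i; rewrite !mxE; move: (2 / _) (dot v w) (dot v _) => k a c.
by apply/eqP; rewrite eq_complex /=; apply/andP; split; apply/eqP; ring.
Qed.

Lemma reflection_unitary w : reflection w \is unitarymx.
Proof.
apply: unitary_of_dot => u v; rewrite !cact_reflection.
have [w0|w0] := eqVneq w 0.
  by rewrite w0 J00 !scaler0 addr0 !scaler0 !subr0.
have ww : dot w w != 0 by rewrite gt_eqF ?dot_gt0.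
rewrite -!(scaleNr (2 / dot w w)) !(dotDl, dotDr, dotZl, dotZr) !dot_J0J0 dot_p_J0p dot_J0_diag.
rewrite (dotC w v) (dotC (J0 w) v).
by field.
Qed.

Definition phase (a c : R) : 'M[R[i]]_n := (a +i* c)%:M.

Lemma cact_phase a c v : cact (phase a c) v = a *: v + c *: J0 v.
Proof.
apply: toC_inj; rewrite toC_cact /phase tr_scalar_mx mul_mx_scalar toCD !toCZ toC_J0.
apply/rowP => i; rewrite !mxE.
by apply/eqP; rewrite eq_complex /=; apply/andP; split; apply/eqP; ring.
Qed.

Lemma phase_unitary a c : a ^+ 2 + c ^+ 2 = 1 -> phase a c \is unitarymx.
Proof.
move=> ac; apply: unitary_of_dot => u v; rewrite !cact_phase.
rewrite !(dotDl, dotDr, dotZl, dotZr) dot_J0J0 dot_J0r.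
by rewrite -[RHS]mul1r -ac; ring.
Qed.

Lemma cact_unitary_surj (A : 'M[R[i]]_n) u : A \is unitarymx ->
  exists v, cact A v = u.
Proof.
move=> uA; exists (cact (invmx A) u).
by rewrite cactM mulmxV ?cact1 // unitarymx_unit.
Qed.

(** U(n) is transitive on spheres: a phase makes the Hermitian product of the
    two vectors real, and then the reflection along their difference exchanges
    them. *)
Lemma unitary_transitive u v : dot u u = dot v v ->
  exists2 A : 'M[R[i]]_n, A \is unitarymx & cact A u = v.
Proof.
move=> uv; set al := dot v u; set ga := dot v (J0 u).
pose rho := Num.sqrt (al ^+ 2 + ga ^+ 2).
have rho2 : rho ^+ 2 = al ^+ 2 + ga ^+ 2.
  by rewrite sqr_sqrtr // addr_ge0 ?sqr_ge0.
have [a [c [ac1 real]]] : exists a c, a ^+ 2 + c ^+ 2 = 1 /\ a * ga - c * al = 0.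
  have [rho0|rho0] := eqVneq rho 0.
    have : al ^+ 2 + ga ^+ 2 == 0 by rewrite -rho2 rho0 expr0n.
    rewrite paddr_eq0 ?sqr_ge0 // !sqrf_eq0 => /andP[/eqP al0 /eqP ga0].
    by exists 1, 0; rewrite al0 ga0; split; ring.
  exists (al / rho), (ga / rho); split; last by field.
  by rewrite !expr_div_n -mulrDl -rho2 divff // expf_neq0.
pose x := a *: u + c *: J0 u; pose w := x - v.
have uP := phase_unitary ac1.
have xx : dot x x = dot v v by rewrite /x -cact_phase dot_cact.
have xJv : dot x (J0 v) = 0.
  rewrite /x dotDl !dotZl dot_J0J0 (dotC u v) -/al dot_J0r (dotC _ v) -/ga.
  by rewrite -oppr0 -real; ring.
exists (reflection w *m phase a c).
  exact: mul_unitarymx (reflection_unitary w) uP.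
rewrite -cactM cact_phase -/x cact_reflection.
have xJw : dot x (J0 w) = 0.
  by rewrite /w J0D J0N dotDr dotNr xJv subr0 dot_p_J0p.
have xw : dot x w = dot v v - dot x v by rewrite /w dotDr dotNr xx.
have ww : dot w w = 2 * (dot v v - dot x v).
  by rewrite {1}/w dotDl dotNl xw /w dotDr dotNr (dotC v x); ring.
have [w0|w0] := eqVneq w 0.
  (* Here the reflection degenerates to the identity. *)
  rewrite w0 J00 !scaler0 addr0 scaler0 subr0.
  by apply/eqP; rewrite -subr_eq0 -/w w0.
have := dot_gt0 w0; rewrite ww => w_gt0.
have k0 : dot v v - dot x v != 0 by rewrite gt_eqF // -(pmulr_rgt0 _ (ltr0n R 2)).
rewrite xJw scale0r addr0 scalerA xw (_ : 2 / _ * _ = 1); last by field.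
by rewrite scale1r /w opprB addrC subrK.
Qed.

End UnitaryMaps.

Section NormalForm.
Context {R : realType} {n : nat}.
Variables (I : set R) (n_ge2 : (2 <= n)%N).
Hypothesis I_gt0 : forall t, I t -> 0 < t.
Variable g : 'rV[R]_(n + n) -> 'M[R]_(n + n).
Let U : set 'rV[R]_(n + n) := (zsq @^-1` I)%classic.
Hypotheses (symg : forall p, U p -> (g p)^T = g p)
  (Jg : forall p u v, U p -> inner g p (J0 u) (J0 v) = inner g p u v)
  (ginv : Un_invariant U g).
Implicit Types (p u v w : 'rV[R]_(n + n)).

Let i0 : 'I_n := Ordinal (ltnW n_ge2).
Let i1 : 'I_n := Ordinal n_ge2.
Local Notation ray := (ray_point n_ge2).

Lemma inner_basis p i j : inner g p (std_basis i) (std_basis j) = g p i j.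
Proof.
rewrite /inner /std_basis -rowE trmx_delta -colE.
by rewrite !mxE.
Qed.

Lemma inner_sym p u v : U p -> inner g p u v = inner g p v u.
Proof.
move=> Up; rewrite /inner.
have -> : u *m g p *m v^T = (v *m g p *m u^T)^T.
  by rewrite !trmx_mul trmxK symg // mulmxA.
by rewrite mxE.
Qed.

Lemma innerNl p u v : inner g p (- u) v = - inner g p u v.
Proof. by rewrite /inner !mulNmx mxE. Qed.

Lemma innerNr p u v : inner g p u (- v) = - inner g p u v.
Proof. by rewrite /inner linearN /= mulmxN mxE. Qed.

Definition radial_coef t := inner g (ray t) (e_x i0) (e_x i0).
Definition transverse_coef t := inner g (ray t) (e_x i1) (e_x i1).

Section AtRay.
Variables (t : R).
Hypothesis It : I t.
Let p := ray t.

Let Up : U p.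
Proof. by rewrite /U /= zsq_ray_point // ltW ?I_gt0. Qed.

Lemma inner_reflection w u v : dot p w = 0 -> dot p (J0 w) = 0 ->
  inner g p (cact (reflection w) u) (cact (reflection w) v) = inner g p u v.
Proof.
move=> pw pJw; have := ginv (reflection_unitary w) u v Up.
have -> // : cact (reflection w) p = p.
by rewrite cact_reflection pw pJw !scale0r addr0 scaler0 subr0.
Qed.

Lemma dot_ray_e_x k : k != i0 -> dot p (e_x k) = 0 /\ dot p (J0 (e_x k)) = 0.
Proof.
move=> k0; rewrite /p /ray_point !dotZl dot_e_x J0_e_x dot_basis_basis eq_lrshift.
by rewrite eq_sym (negbTE k0) !mulr0.
Qed.

Lemma reflection_e_x k j :
  cact (reflection (e_x k)) (e_x j) = (if k == j then - e_x j else e_x j) :> 'rV[R]_(n + n).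
Proof.
rewrite cact_reflection J0_e_x !dot_e_x dot_basis_basis eq_lrshift scale0r addr0 eqxx.
rewrite divr1 eq_sym; have [->|_] := eqVneq k j; last by rewrite scale0r scaler0 subr0.
by rewrite scale1r scaler_nat mulr2n opprD addrA subrr sub0r.
Qed.

(** One of two distinct indices is not the one of the ray, and the reflection
    that changes the sign of that coordinate fixes the ray. *)
Lemma inner_e_x_e_x i j : i != j -> inner g p (e_x i) (e_x j) = 0.
Proof.
move=> ij; have [k [k0 kij]] : exists k, k != i0 /\ (k = i \/ k = j).
  have [ii0|ii0] := eqVneq i i0; last by exists i; split => //; left.
  by exists j; split; [rewrite -ii0 eq_sym | right].
have [pk pJk] := dot_ray_e_x k0; have := inner_reflection (e_x i) (e_x j) pk pJk.
rewrite !reflection_e_x; case: kij => ->; rewrite eqxx.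
  by rewrite (negbTE ij) innerNl => h; lra.
by rewrite eq_sym (negbTE ij) innerNr => h; lra.
Qed.

Lemma inner_e_x_e_y i j : inner g p (e_x i) (e_y j) = 0.
Proof.
rewrite -J0_e_x; have [->|ij] := eqVneq i j.
  by have := Jg (e_x j) (J0 (e_x j)) Up; rewrite J0K innerNr inner_sym // => h; lra.
have [k [k0 kij]] : exists k, k != i0 /\ (k = i \/ k = j).
  have [ii0|ii0] := eqVneq i i0; last by exists i; split => //; left.
  by exists j; split; [rewrite -ii0 eq_sym | right].
have [pk pJk] := dot_ray_e_x k0; have := inner_reflection (e_x i) (J0 (e_x j)) pk pJk.
rewrite -J0_cact !reflection_e_x; case: kij => ->; rewrite eqxx.
  by rewrite (negbTE ij) innerNl => h; lra.
by rewrite eq_sym (negbTE ij) J0N innerNr => h; lra.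
Qed.

(** The reflection along [e_x i - e_x i1] exchanges the two coordinates. *)
Lemma inner_e_x_transverse i : i != i0 ->
  inner g p (e_x i) (e_x i) = transverse_coef t.
Proof.
move=> ii0; rewrite /transverse_coef -/p.
have [->//|ii1] := eqVneq i i1.
have i10 : i1 != i0 by [].
pose w : 'rV[R]_(n + n) := e_x i - e_x i1.
have [pi pJi] := dot_ray_e_x ii0; have [pi1 pJi1] := dot_ray_e_x i10.
have pw : dot p w = 0 by rewrite dotDr dotNr pi pi1 subr0.
have pJw : dot p (J0 w) = 0 by rewrite J0D J0N dotDr dotNr pJi pJi1 subr0.
rewrite -(inner_reflection (e_x i) (e_x i) pw pJw) cact_reflection.
have xw : dot (e_x i) w = 1.
  by rewrite dotDr dotNr !dot_e_x eqxx (negbTE ii1) subr0.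
have xJw : dot (e_x i) (J0 w) = 0.
  by rewrite J0D J0N !J0_e_x dotDr dotNr !dot_basis_basis !eq_lrshift subr0.
have ww : dot w w = 2.
  rewrite dotDl dotNl xw dotDr dotNr !dot_e_x eqxx eq_sym (negbTE ii1) /=; ring.
rewrite xw xJw ww scale0r addr0 divff ?pnatr_eq0 // !scale1r.
by rewrite /w opprB addrC subrK.
Qed.

Lemma metric_at_ray :
  g p = rot_mx (transverse_coef t) ((radial_coef t - transverse_coef t) / t) p.
Proof.
have t0 : t != 0 by rewrite gt_eqF ?I_gt0.
have tt : Num.sqrt t * Num.sqrt t = t by rewrite -expr2 sqr_sqrtr // ltW ?I_gt0.
have Bxx i j : inner g p (e_x i) (e_x j) =
    rot_form (transverse_coef t) ((radial_coef t - transverse_coef t) / t) p (e_x i) (e_x j).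
  rewrite /rot_form {2 3 4 5}/p /ray_point J0Z !dotZl J0_e_x !dot_e_x.
  rewrite !dot_basis_basis !eq_rlshift !mulr0 addr0.
  have [<-|ij] := eqVneq i j; last first.
    rewrite inner_e_x_e_x // !mulr0 add0r.
    have [i0i|_] := eqVneq i0 i; last by rewrite !mulr0 mul0r mulr0.
    by rewrite -i0i in ij; rewrite (negbTE ij) !mulr0.
  have [<-|i0i] := eqVneq i0 i.
    by rewrite !mulr1 tt -/(radial_coef t); field.
  by rewrite inner_e_x_transverse ?[i == _]eq_sym // !mulr0 addr0 mulr1.
have Bxy i j : inner g p (e_x i) (e_y j) =
    rot_form (transverse_coef t) ((radial_coef t - transverse_coef t) / t) p (e_x i) (e_y j).
  rewrite inner_e_x_e_y /rot_form /p /ray_point J0Z !dotZl J0_e_x.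
  by rewrite !dot_basis_basis !eq_rlshift !eq_lrshift !(mulr0n, mulr0, mul0r, addr0).
have Byx i j : inner g p (e_y i) (e_x j) =
    rot_form (transverse_coef t) ((radial_coef t - transverse_coef t) / t) p (e_y i) (e_x j).
  rewrite inner_sym // inner_e_x_e_y /rot_form /p /ray_point J0Z !dotZl J0_e_x.
  by rewrite !dot_basis_basis !eq_rlshift !eq_lrshift !(mulr0n, mulr0, mul0r, addr0).
apply/matrixP => a b; rewrite rot_mxE -inner_basis.
rewrite -(fintype.splitK a) -(fintype.splitK b).
case: (fintype.split a) => i; case: (fintype.split b) => j /=.
- exact: Bxx.
- exact: Bxy.
- exact: Byx.
- by rewrite -!/(e_y _) -!J0_e_x rot_form_J0 Jg // Bxx.
Qed.

End AtRay.

(** Transport along U(n) reduces the claim to one ray, where the reflections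
    in the remaining coordinates diagonalise the metric. *)
Lemma Un_invariant_normal_form p : U p ->
  g p = rot_mx (transverse_coef (zsq p))
    ((radial_coef (zsq p) - transverse_coef (zsq p)) / zsq p) p.
Proof.
move=> Up; have Ip : I (zsq p) by [].
have z0 : 0 <= zsq p by rewrite ltW ?I_gt0.
have norms : dot (ray (zsq p)) (ray (zsq p)) = dot p p.
  by rewrite -!zsqE zsq_ray_point.
have [A uA Ap] := unitary_transitive norms.
have Ur : U (ray (zsq p)) by rewrite /U /= zsq_ray_point.
apply/matrixP => i j; rewrite rot_mxE -inner_basis.
have [u <-] := cact_unitary_surj (std_basis i) uA.
have [v <-] := cact_unitary_surj (std_basis j) uA.
rewrite -{1 6}Ap ginv // rot_form_cact // /inner metric_at_ray //.
by rewrite inner_rot_mx.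
Qed.

End NormalForm.

(** * A Riccati equation *)

Section Riccati.
Context {R : realType}.
Variable I : set R.
Hypothesis I_itv : forall s t x, I s -> I t -> s <= x <= t -> I x.

(** On a compact interval [c] is bounded by some [K], and then
    [D ^+ 2 * expR (- 2 * K * x)] is monotone; it vanishes at [t0]. *)
Lemma linear_ode_zero (c D : R -> R) t0 :
  (forall t, I t -> {for t, continuous c}) ->
  (forall t, I t -> is_derive t 1 D (c t * D t)) ->
  I t0 -> D t0 = 0 -> forall t, I t -> D t = 0.
Proof.
move=> cc dD It0 D0 t It.
have within (a b : R) (h : R -> R) : I a -> I b ->
    (forall x, I x -> {for x, continuous h}) ->
    {within `[a, b], continuous h}%classic.
  move=> Ia Ib ch; apply: continuous_in_subspaceT => x; rewrite inE /= in_itv /= => xab.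
  by apply: ch; exact: I_itv Ia Ib xab.
have dexp K x : I x -> is_derive x 1 (fun x => D x ^+ 2 * expR (- (2 * K) * x))
    (2 * (c x - K) * (D x ^+ 2 * expR (- (2 * K) * x))).
  move=> Ix; have De := is_derive_mul (is_derive_const (- (2 * K)) x 1) (is_derive_id x 1).
  have Dm := is_derive_mul (is_derive_exp 2 (dD x Ix)) (is_derive_compose (is_derive_expR _) De).
  by apply: (is_derive_eq Dm); rewrite /=; ring.
have zero K : D t ^+ 2 * expR (- (2 * K) * t) <= D t0 ^+ 2 * expR (- (2 * K) * t0) ->
    D t = 0.
  rewrite D0 expr0n mul0r pmulr_lle0 ?expR_gt0 // => D2.
  by apply/eqP; rewrite -sqrf_eq0 eq_le D2 sqr_ge0.
have cexp K x : I x -> {for x, continuous (fun x => D x ^+ 2 * expR (- (2 * K) * x))}.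
  by move=> Ix; exact: is_derive1_cont (dexp K x Ix).
have pos K x : 0 <= D x ^+ 2 * expR (- (2 * K) * x).
  by rewrite mulr_ge0 ?sqr_ge0 ?expR_ge0.
have [tt0|t0t] := leP t t0.
  (* To the left of [t0] a lower bound makes the function nondecreasing. *)
  have [K _ Kmin] := EVT_min tt0 (within _ _ _ It It0 cc).
  have I_oo x : x \in `]t, t0[ -> I x.
    by rewrite in_itv /= => /andP[h1 h2]; apply: (I_itv It It0); rewrite !ltW.
  apply: (zero (c K)).
  apply: (@ger0_derive1_ndecr _ (fun x => D x ^+ 2 * expR (- (2 * c K) * x)) t t0) => //.
  - by move=> x /I_oo /(dexp (c K))[].
  - move=> x xt; rewrite derive1E; have [_ ->] := dexp (c K) x (I_oo x xt).
    rewrite mulr_ge0 // mulr_ge0 // subr_ge0 Kmin //.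
    by move: xt; rewrite !in_itv /= => /andP[h1 h2]; rewrite !ltW.
  - by apply: within => // x; exact: cexp.
have [K _ Kmax] := EVT_max (ltW t0t) (within _ _ _ It0 It cc).
have I_oo x : x \in `]t0, t[ -> I x.
  by rewrite in_itv /= => /andP[h1 h2]; apply: (I_itv It0 It); rewrite !ltW.
apply: (zero (c K)).
apply: (@ler0_derive1_nincr _ (fun x => D x ^+ 2 * expR (- (2 * c K) * x)) t0 t) => //; last exact: ltW.
- by move=> x /I_oo /(dexp (c K))[].
- move=> x xt; rewrite derive1E; have [_ ->] := dexp (c K) x (I_oo x xt).
  rewrite mulr_le0_ge0 // mulr_ge0_le0 // subr_le0 Kmax //.
  by move: xt; rewrite !in_itv /= => /andP[h1 h2]; rewrite !ltW.
- by apply: within => // x; exact: cexp.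
Qed.

(** [y = 2 / (P + k)] solves [y' = - P' y ^ 2 / 2]; the defect
    [y * (P + k) - 2] of an arbitrary solution satisfies a linear equation. *)
Lemma riccati_solution (y P P1 : R -> R) t0 :
  (forall t, I t -> {for t, continuous P1}) ->
  (forall t, I t -> is_derive t 1 P (P1 t)) ->
  (forall t, I t -> is_derive t 1 y (- (P1 t * y t ^+ 2 / 2))) ->
  I t0 -> y t0 != 0 -> exists k, forall t, I t -> y t * (P t + k) = 2.
Proof.
move=> cP dP dy It0 y0; exists (2 / y t0 - P t0) => t It; apply/eqP.
rewrite -subr_eq0; apply/eqP.
pose D t := y t * (P t + (2 / y t0 - P t0)) - 2.
apply: (@linear_ode_zero (fun t => - (2^-1 * (y t * P1 t))) D t0) => // [s Is|s Is|].
- apply: continuousN; apply: continuousM; first exact: cst_continuous.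
  by apply: continuousM; [exact: is_derive1_cont (dy s Is) | exact: cP].
- have Dd := is_derive_sub (is_derive_mul (dy s Is) (is_derive_add (dP s Is)
    (is_derive_const (2 / y t0 - P t0) s 1))) (is_derive_const 2 s 1).
  by apply: (is_derive_eq Dd); rewrite /D; field.
- by rewrite /D; field.
Qed.

End Riccati.

(** * Classification *)

Section RadialMetric.
Context {R : realType} {n : nat}.
Variables (I : set R) (E F : R -> R).
Hypotheses (oI : open I) (n_ge2 : (2 <= n)%N) (I_gt0 : forall t, I t -> 0 < t)
  (smoothE : smooth_on I E) (smoothF : smooth_on I F)
  (E_gt0 : forall t, I t -> 0 < E t) (F_gt0 : forall t, I t -> 0 < F t).
Variable g : 'rV[R]_(n + n) -> 'M[R]_(n + n).
Let U : set 'rV[R]_(n + n) := (zsq @^-1` I)%classic.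
Hypothesis gE : forall q, U q -> g q = Un_metric E F q.

Let b t := (E t - F t) / t.

Let smoothb : smooth_on I b.
Proof.
apply: smooth_on_mul => //; first exact: smooth_on_sub.
apply: smooth_on_inv => //; last exact: smooth_on_id.
by move=> t It; rewrite gt_eqF ?I_gt0.
Qed.

Let gE' q : U q -> g q = rot_mx (F (zsq q)) (b (zsq q)) q.
Proof. by move=> Uq; rewrite gE // Un_metricE // I_gt0. Qed.

Let eE t : I t -> F t + t * b t = E t.
Proof.
move=> It; have t0 : t != 0 by rewrite gt_eqF ?I_gt0.
by rewrite /b; field.
Qed.

Let e_gt0 t : I t -> 0 < F t + t * b t.
Proof. by move=> It; rewrite eE // E_gt0. Qed.

Let openU : open U.
Proof. by apply: open_comp => // q _; exact: continuous_zsq. Qed.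

Lemma inner_radial q u v : U q ->
  inner g q u v = rot_form (F (zsq q)) (b (zsq q)) q u v.
Proof. by move=> Uq; rewrite /inner gE' // inner_rot_mx. Qed.

(** Bessel's inequality for [p] and [J0 p]. *)
Lemma bessel_J0 (p v : 'rV[R]_(n + n)) :
  0 < zsq p -> dot p v ^+ 2 + dot (J0 p) v ^+ 2 <= zsq p * dot v v.
Proof.
move=> z0; rewrite -subr_ge0 -(pmulr_rge0 _ z0).
have := dot_ge0 (zsq p *: v - dot p v *: p - dot (J0 p) v *: J0 p).
congr (0 <= _); rewrite -!scaleNr !(dotDl, dotDr, dotZl, dotZr).
rewrite dot_p_J0p dot_J0_diag dot_J0p_J0p -(zsqE p) (dotC v p) (dotC v (J0 p)).
by ring.
Qed.

Lemma hermitian_radial : hermitian_metric U g.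
Proof.
split; last first.
  move=> p u v Up; rewrite !inner_radial //; exact: rot_form_J0.
split=> [i j|p Up|p v Up v0].
- apply: (smooth_on_eq (f := fun q => rot_form (F (zsq q)) (b (zsq q)) q
    (std_basis i) (std_basis j))) => //.
    by move=> q Uq; rewrite gE' // rot_mxE.
  have sz : smooth_on U zsq by exact: smooth_on_zsq.
  have sr (h : R -> R) : smooth_on I h -> smooth_on U (fun q => h (zsq q)).
    by move=> sh; exact: (smooth_on_comp openU oI).
  have sp k : smooth_on U (fun q => dot q (std_basis k)).
    by apply: smooth_on_dot => // a; [exact: smooth_on_coord | exact: smooth_on_cst].
  have sq k : smooth_on U (fun q => dot (J0 q) (std_basis k)).
    by apply: smooth_on_dot => // a; [exact: smooth_on_J0 | exact: smooth_on_cst].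
  apply: smooth_on_add => //; apply: smooth_on_mul => //.
  + exact: sr.
  + exact: smooth_on_cst.
  + exact: sr.
  + by apply: smooth_on_add => //; exact: smooth_on_mul.
- apply/matrixP => i j; rewrite mxE gE' // !rot_mxE /rot_form (dotC (std_basis j)).
  by ring.
- have z0 : 0 < zsq p by exact: I_gt0.
  rewrite inner_radial // /rot_form -!expr2.
  have := bessel_J0 v z0; set W := dot p v ^+ 2 + _ => Wle.
  have W0 : 0 <= W by rewrite addr_ge0 ?sqr_ge0.
  have vv := dot_gt0 v0; have Ez := E_gt0 Up; have Fz := F_gt0 Up.
  have -> : F (zsq p) * dot v v + b (zsq p) * W =
      (F (zsq p) * (zsq p * dot v v - W) + E (zsq p) * W) / zsq p.
    by rewrite /b; field; rewrite gt_eqF.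
  rewrite divr_gt0 //; have [Wz|Wz] := eqVneq W 0.
    by rewrite Wz mulr0 addr0 subr0 !mulr_gt0.
  rewrite ltr_wpDl ?mulr_ge0 ?subr_ge0 // ?ltW // mulr_gt0 //.
  by rewrite lt_neqAle eq_sym Wz W0.
Qed.

Lemma Un_invariant_radial : Un_invariant U g.
Proof.
move=> A uA p u v Up.
have zA : zsq (cact A p) = zsq p by rewrite !zsqE dot_cact.
by rewrite !inner_radial //= ?zA // ?rot_form_cact // /U /= zA.
Qed.

(** A multiple of the torsion [F' - (E - F) / t], chosen so that the Klsc
    equation becomes a Riccati equation. *)
Definition torsion_coef t : R :=
  t ^+ n * F t ^+ (n - 2) * (derive1 F t - (E t - F t) / t).

(** The weight [t ^+ n * F t ^+ (n - 2)] is an integrating factor for the linear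
    part of [klsc_ode]; the quadratic term survives. *)
Lemma klsc_riccati : klsc U g <-> forall t, I t -> is_derive t 1 torsion_coef
  (- ((t ^+ n * F t ^+ (n - 1))^-1 * torsion_coef t ^+ 2 / 2)).
Proof.
have D1 (h : R -> R) (t : R) : smooth_on I h -> I t -> is_derive t 1 h (derive1 h t).
  by move=> sh It; exact: smooth_on_is_derive1 sh It.
have sF1 := smooth_on_derive1 smoothF; have sb1 := smooth_on_derive1 smoothb.
have ode := klsc_ode oI n_ge2 I_gt0 (fun t => D1 F t smoothF)
  (fun t => D1 _ t sF1) (fun t => D1 b t smoothb) (fun t => D1 _ t sb1) F_gt0 e_gt0 gE'.
set f1 := derive1 F in ode D1 sF1 *; set f2 := derive1 f1 in ode.
set b1 := derive1 b in ode D1 sb1.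
pose m := (n - 2)%N; have nE : n = m.+2 by rewrite /m -addn2 subnK.
have n1E : (n - 1)%N = m.+1 by rewrite nE subn1.
have D t : I t -> is_derive t 1 torsion_coef (t ^+ m.+1 * F t ^+ m *
    (n%:R * (f1 t - b t) + t * (f2 t - b1 t)
     + (n%:R - 2) * t * (f1 t - b t) * f1 t / F t)).
  move=> It; have F0 : F t != 0 by rewrite gt_eqF ?F_gt0.
  have Dn := is_derive_exp n (is_derive_id t 1).
  have DF := is_derive_exp m (D1 F t smoothF It).
  have Ds := is_derive_sub (D1 f1 t sF1 It) (D1 b t smoothb It).
  apply: (is_derive_eq (is_derive_mul (is_derive_mul Dn DF) Ds)).
  have nR : n%:R = m%:R + 2 :> R by rewrite nE -addn2 natrD.
  rewrite -/f1 -/f2 -/b1 nR (_ : n.-1 = m.+1) ?nE // !exprS.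
  (* For [n = 2] the exponent [m.-1] is truncated, but the factor [m] is 0. *)
  have -> : m%:R * F t ^+ m.-1 = m%:R * (F t ^+ m / F t).
    by case: (m) => [|k]; rewrite ?mul0r // exprSr mulfK.
  by field.
have eqv t : I t -> t ^+ m.+1 * F t ^+ m *
    (n%:R * (f1 t - b t) + t * (f2 t - b1 t)
     + (n%:R - 2) * t * (f1 t - b t) * f1 t / F t)
    - (- ((t ^+ n * F t ^+ (n - 1))^-1 * torsion_coef t ^+ 2 / 2)) =
    t ^+ m.+1 * F t ^+ m * (n%:R * (f1 t - b t) + t * (f2 t - b1 t)
     + (n%:R - 2) * t * (f1 t - b t) * f1 t / F t
     + t * (f1 t - b t) ^+ 2 / (2 * F t)).
  move=> It; have F0 : F t != 0 by rewrite gt_eqF ?F_gt0.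
  have t0 : t != 0 by rewrite gt_eqF ?I_gt0.
  rewrite /torsion_coef -/m -/f1 -/(b t) n1E nE !exprS.
  by field; rewrite F0 t0 !expf_neq0.
have pos t : I t -> t ^+ m.+1 * F t ^+ m != 0.
  by move=> It; rewrite mulf_neq0 // expf_neq0 // gt_eqF ?F_gt0 ?I_gt0.
split=> [/ode K t It|K].
  apply: (is_derive_eq (D t It)); apply/eqP; rewrite -subr_eq0 eqv //.
  by rewrite K // mulr0.
apply/ode => t It; have [_ d1] := D t It; have [_ d2] := K t It.
have /eqP := eqv t It; rewrite -d1 -d2 subrr eq_sym mulf_eq0 (negbTE (pos t It)).
by move/eqP.
Qed.

Lemma kahler_torsion : kahler U g <-> forall t, I t -> torsion_coef t = 0.
Proof.
have D1 (h : R -> R) (t : R) : smooth_on I h -> I t -> is_derive t 1 h (derive1 h t).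
  by move=> sh It; exact: smooth_on_is_derive1 sh It.
have K := kahler_rot oI n_ge2 I_gt0 (fun t => D1 F t smoothF)
  (fun t => D1 b t smoothb) gE'.
split=> [/K h t It|h]; first by rewrite /torsion_coef h // subrr mulr0.
apply/K => t It; have /eqP := h t It; rewrite /torsion_coef mulf_eq0 subr_eq0.
rewrite (_ : _ == 0 = false) ?orFb => [/eqP//|].
by apply/negbTE; rewrite mulf_neq0 // expf_neq0 // gt_eqF ?F_gt0 ?I_gt0.
Qed.

End RadialMetric.

Arguments torsion_coef {R} n E F t.

Section Classification.
Context {R : realType} (n : nat) (alpha : R) (beta : \bar R)
    (Prim : (R -> R) -> R -> R).
Hypotheses (n_ge2 : (2 <= n)%N) (alpha_ge0 : 0 <= alpha) (lt_ab : (alpha%:E < beta)%E)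
    (PrimP : antiderivative_choice n alpha beta Prim).
Let I := radii alpha beta.
Let oI : open I := @open_radii R alpha beta.

Lemma radii_gt0 t : I t -> 0 < t.
Proof. by move=> /andP[]; rewrite lte_fin => a_lt _; exact: le_lt_trans a_lt. Qed.

Lemma radii_itv s t x : I s -> I t -> s <= x <= t -> I x.
Proof.
move=> /andP[as_ _] /andP[_ tb] /andP[sx xt]; apply/andP; split.
  by apply: lt_le_trans as_ _; rewrite lee_fin.
by apply: le_lt_trans tb; rewrite lee_fin.
Qed.

Lemma radii_neq0 : exists t, I t.
Proof.
rewrite /I /radii /=; case: beta lt_ab => [b| |] //=; rewrite ?lte_fin => ab.
  exists ((alpha + b) / 2); rewrite !lte_fin; apply/andP; split; lra.
by exists (alpha + 1); rewrite lte_fin ltry andbT; lra.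
Qed.

Section Pair.
Variables (F : R -> R) (C : R).
Hypotheses (smoothF : smooth_on I F) (F_gt0 : forall t, I t -> 0 < F t).

Let k : R := (2 * n%:R - 1) * C.

(** The coefficient of the radial and fibre part in [g_pair]. *)
Definition pair_radial t : R := derive1 (fun s : R => s * F s) t
  - 2 / (t ^+ (n - 1) * F t ^+ (n - 2)) * (Prim F t + (2 * n%:R - 1) * C)^-1.

Lemma nR_gt0 : 0 < 2 * n%:R - 1 :> R.
Proof.
have : 2 <= n%:R :> R by rewrite ler_nat.
lra.
Qed.

Lemma F_neq0 t : I t -> F t != 0.
Proof. by move=> It; rewrite gt_eqF ?F_gt0. Qed.

Lemma t_neq0 t : I t -> t != 0.
Proof. by move=> It; rewrite gt_eqF ?radii_gt0. Qed.

Lemma PrimE t : I t -> is_derive t 1 (Prim F) (t ^+ n * F t ^+ (n - 1))^-1.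
Proof. by case: PrimP => + _; apply. Qed.

Lemma smooth_density : smooth_on I (fun t => (t ^+ n * F t ^+ (n - 1))^-1).
Proof.
apply: smooth_on_inv => //.
  by move=> t It; rewrite mulf_neq0 ?expf_neq0 ?(t_neq0 It) ?(F_neq0 It).
by apply: smooth_on_mul => //; apply: smooth_on_exp => //; exact: smooth_on_id.
Qed.

Lemma derive_tF t : I t ->
  derive1 (fun s : R => s * F s) t = F t + t * derive1 F t.
Proof.
move=> It; rewrite derive1E.
have [_ ->] := is_derive_mul (is_derive_id t 1) (smooth_on_is_derive1 smoothF It).
by rewrite mul1r.
Qed.

Lemma smooth_pair_radial : (forall t, I t -> Prim F t + k != 0) ->
  smooth_on I pair_radial.
Proof.
move=> k0; apply: smooth_on_sub => //.
  apply: (@smooth_on_derive1 R I (fun s => s * F s)).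
  by apply: smooth_on_mul => //; exact: smooth_on_id.
apply: smooth_on_mul => //.
  apply: smooth_on_mul => //; first exact: smooth_on_cst.
  apply: smooth_on_inv => //.
    by move=> t It; rewrite mulf_neq0 ?expf_neq0 ?(t_neq0 It) ?(F_neq0 It).
  by apply: smooth_on_mul => //; apply: smooth_on_exp => //; exact: smooth_on_id.
apply: smooth_on_inv => //; apply: smooth_on_add => //; last exact: smooth_on_cst.
exact: smooth_on_primitive PrimE smooth_density.
Qed.

(** Hence the radial coefficient is positive exactly when the function of the
    admissibility condition has positive derivative. *)
Lemma admissible_derive t : I t -> Prim F t + k != 0 ->
  derive1 (fun s : R => s * F s * ((2 * n%:R - 1)^-1 * Prim F s + C) ^- 2) t
  = pair_radial t * ((2 * n%:R - 1)^-1 * Prim F t + C) ^- 2.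
Proof.
move=> It k0; have N0 : 2 * n%:R - 1 != 0 :> R by rewrite gt_eqF ?nR_gt0.
have F0 := F_neq0 It; have t0 := t_neq0 It.
set G := fun s => (2 * n%:R - 1)^-1 * Prim F s + C.
have Gk : (2 * n%:R - 1) * G t = Prim F t + k.
  by rewrite /G /k; field.
have G0 : G t != 0 by apply: contra_neq k0 => G0; rewrite -Gk G0 mulr0.
have DG : is_derive t 1 G _ := is_derive_add (is_derive_mul
  (is_derive_const (2 * n%:R - 1)^-1 t 1) (PrimE It)) (is_derive_const C t 1).
have G20 : G t ^+ 2 != 0 by rewrite expf_neq0.
have DtF := is_derive_mul (is_derive_id t 1) (smooth_on_is_derive1 smoothF It).
have [_ D] := is_derive_mul DtF
  (is_derive_inv (f := fun s => G s ^+ 2) G20 (is_derive_exp 2 DG)).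
rewrite derive1E; refine (etrans D _); rewrite -[RHS]/(_ * G t ^- 2).
rewrite /pair_radial derive_tF // -/k -Gk.
have -> : (n - 1 = (n - 2).+1)%N by rewrite -subSn.
have -> : t ^+ n = t * (t * t ^+ (n - 2)) by rewrite -!exprS -addn2 subnK.
move: (G t) (n%:R : R) G0 G20 N0 => Gt N G0 G20 N0.
rewrite !exprS /=; field; rewrite N0 G0 t0 F0 !expf_neq0 //.
Qed.

(** The explicit formula for the radial coefficient is the formula for the
    solutions of the Riccati equation, solved for [E]. *)
Lemma torsion_pair (E : R -> R) t : I t -> Prim F t + k != 0 ->
  E t = pair_radial t <-> torsion_coef n E F t * (Prim F t + k) = 2.
Proof.
move=> It k0; have F0 := F_neq0 It; have t0 := t_neq0 It.
have tn : t ^+ n = t * (t * t ^+ (n - 2)) by rewrite -!exprS -addn2 subnK.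
have n1E : (n - 1 = (n - 2).+1)%N by rewrite -subSn.
have key : torsion_coef n E F t * (Prim F t + k) - 2 =
    (t ^+ (n - 1) * F t ^+ (n - 2) * (Prim F t + k)) * (pair_radial t - E t).
  rewrite /torsion_coef /pair_radial derive_tF // -/k n1E tn !exprS.
  by field; rewrite k0 t0 !expf_neq0.
have nz : t ^+ (n - 1) * F t ^+ (n - 2) * (Prim F t + k) != 0.
  by rewrite !mulf_neq0 ?expf_neq0.
split=> [h|/eqP]; first by apply/eqP; rewrite -subr_eq0 key h subrr mulr0.
by rewrite -subr_eq0 key mulf_eq0 (negbTE nz) subr_eq0 => /eqP.
Qed.

End Pair.

Lemma Un_metric_eq (E E' F : R -> R) (p : 'rV[R]_(n + n)) :
  E (zsq p) = E' (zsq p) -> Un_metric E F p = Un_metric E' F p.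
Proof. by move=> EE; apply/matrixP => i j; rewrite !mxE EE. Qed.

Lemma admissible_klsc F C (g : 'rV[R]_(n + n) -> 'M[R]_(n + n)) :
  admissible n alpha beta Prim F C ->
  (forall p, annulus alpha beta p -> g p = g_pair Prim F C p) ->
  Un_nonkahler_klsc (annulus alpha beta) g.
Proof.
case=> -[smoothF F_gt0] G0 incr gE.
pose k := (2 * n%:R - 1) * C.
have N0 : 2 * n%:R - 1 != 0 :> R by rewrite gt_eqF ?nR_gt0.
have k0 t : I t -> Prim F t + k != 0.
  move=> It; apply: contra_neq (G0 t It) => h.
  have -> : (2 * n%:R - 1)^-1 * Prim F t + C = (2 * n%:R - 1)^-1 * (Prim F t + k).
    by rewrite /k; field.
  by rewrite h mulr0.
have E_gt0 t : I t -> 0 < pair_radial F C t.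
  move=> It; have := incr t It; rewrite admissible_derive //; last exact: k0.
  by rewrite pmulr_lgt0 // invr_gt0 exprn_even_gt0 //= G0.
have smoothE := smooth_pair_radial smoothF F_gt0 k0.
have gE' : forall q, I (zsq q) -> g q = Un_metric (pair_radial F C) F q := gE.
have yk t : I t -> torsion_coef n (pair_radial F C) F t * (Prim F t + k) = 2.
  by move=> It; apply/torsion_pair => //; exact: k0.
split.
- exact: (hermitian_radial oI radii_gt0 smoothE smoothF E_gt0 F_gt0 gE').
- exact: (Un_invariant_radial radii_gt0 gE').
- apply/(klsc_riccati oI n_ge2 radii_gt0 smoothE smoothF E_gt0 F_gt0 gE') => t It.
  have D := is_derive_mul (is_derive_const 2 t 1) (is_derive_inv (f := fun t => Prim F t + k)
    (k0 t It) (is_derive_add (PrimE smoothF F_gt0 It) (is_derive_const k t 1))).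
  have ty s : I s -> 2 * (Prim F s + k)^-1 = torsion_coef n (pair_radial F C) F s.
    by move=> Is; rewrite -(yk s Is) mulfK // k0.
  have It' : \forall s \near t, I s by exact: open_nbhs_nbhs.
  apply: near_eq_is_derive (filterS ty It') _.
  apply: (is_derive_eq D); rewrite -(ty t It) addr0 mul0r add0r.
  by field; rewrite k0 // !expf_neq0 ?(t_neq0 It) ?(F_neq0 F_gt0 It).
- move=> /(kahler_torsion oI n_ge2 radii_gt0 smoothE smoothF F_gt0 gE') K.
  have [t It] := radii_neq0; have := yk t It; rewrite K // mul0r => /eqP.
  by rewrite eq_sym pnatr_eq0.
Qed.

Lemma klsc_admissible (g : 'rV[R]_(n + n) -> 'M[R]_(n + n)) :
  Un_nonkahler_klsc (annulus alpha beta) g ->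
  exists F C, admissible n alpha beta Prim F C /\
    forall p, annulus alpha beta p -> g p = g_pair Prim F C p.
Proof.
case=> -[[smg symg posg] Jg] ginv kg nkg.
pose E := radial_coef n_ge2 g; pose F := transverse_coef n_ge2 g.
have Ur t : I t -> annulus alpha beta (ray_point n_ge2 t).
  by move=> It; rewrite /annulus /= zsq_ray_point // ltW // radii_gt0.
have e_x0 (i : 'I_n) : e_x i != 0 :> 'rV[R]_(n + n).
  apply/eqP => /(congr1 (fun v => dot v (e_x i))); rewrite dot_e_x eqxx /dot mul0mx mxE.
  by move/eqP; rewrite oner_eq0.
have E_gt0 t : I t -> 0 < E t by move=> It; apply: posg => //; exact: Ur.
have F_gt0 t : I t -> 0 < F t by move=> It; apply: posg => //; exact: Ur.
have smooth_ray i : smooth_on I (fun t => g (ray_point n_ge2 t) i i).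
  apply: (smooth_on_ray (f := fun q => g q i i) _ oI Ur _ (smg i i)).
    exact: open_annulus.
  by apply: smooth_on_sqrt => // t; exact: radii_gt0.
have smoothE : smooth_on I E.
  rewrite (_ : E = fun t => g (ray_point n_ge2 t) (lshift n (Ordinal (ltnW n_ge2)))
    (lshift n (Ordinal (ltnW n_ge2)))); first exact: smooth_ray.
  by apply/funext => t; rewrite /E /radial_coef inner_basis.
have smoothF : smooth_on I F.
  rewrite (_ : F = fun t => g (ray_point n_ge2 t) (lshift n (Ordinal n_ge2))
    (lshift n (Ordinal n_ge2))); first exact: smooth_ray.
  by apply/funext => t; rewrite /F /transverse_coef inner_basis.
have gE q : I (zsq q) -> g q = Un_metric E F q.
  move=> Iq; rewrite Un_metricE ?radii_gt0 //.
  exact: (Un_invariant_normal_form n_ge2 radii_gt0 symg Jg ginv).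
have /(klsc_riccati oI n_ge2 radii_gt0 smoothE smoothF E_gt0 F_gt0 gE) dy := kg.
(* A solution of the Riccati equation that vanishes somewhere vanishes
   identically, so one point with torsion is enough. *)
have [t0 It0 y0] : exists2 t0, I t0 & torsion_coef n E F t0 != 0.
  apply/not_exists2P => h; apply: nkg.
  apply/(kahler_torsion oI n_ge2 radii_gt0 smoothE smoothF F_gt0 gE) => t It.
  by have [//|/negP] := h t; rewrite negbK => /eqP.
have cP t : I t -> {for t, continuous (fun t : R => (t ^+ n * F t ^+ (n - 1))^-1)}.
  exact: smooth_on_cont (smooth_density smoothF F_gt0).
have [k yk] := riccati_solution radii_itv cP (PrimE smoothF F_gt0) dy It0 y0.
have N0 : 2 * n%:R - 1 != 0 :> R by rewrite gt_eqF ?nR_gt0.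
(* The admissible constant is scaled by [2 n - 1] in the formula for the metric. *)
pose C := k / (2 * n%:R - 1).
have kC : (2 * n%:R - 1) * C = k by rewrite /C mulrCA divff // mulr1.
have k0 t : I t -> Prim F t + (2 * n%:R - 1) * C != 0.
  move=> It; rewrite kC; apply: contra_eq_neq (yk t It) => ->.
  by rewrite mulr0 eq_sym pnatr_eq0.
have EE t : I t -> E t = pair_radial F C t.
  by move=> It; apply/(torsion_pair smoothF F_gt0 E It (k0 t It)); rewrite kC yk.
exists F, C; split; last first.
  by move=> p Up; rewrite gE //; apply: Un_metric_eq; exact: EE.
have G0 t : I t -> (2 * n%:R - 1)^-1 * Prim F t + C != 0.
  move=> It; apply: contra_neq (k0 t It) => h.
  rewrite (_ : _ + _ = (2 * n%:R - 1) * ((2 * n%:R - 1)^-1 * Prim F t + C)); last by field.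
  by rewrite h mulr0.
split=> // t It; rewrite admissible_derive //; last exact: k0.
by rewrite -EE // mulr_gt0 ?E_gt0 // invr_gt0 exprn_even_gt0 //= G0.
Qed.

End Classification.

Theorem theorem1p7 (R : realType) (n : nat) (alpha : R) (beta : \bar R)
    (Prim : (R -> R) -> R -> R)
    (n_ge2 : (2 <= n)%N) (alpha_ge0 : 0 <= alpha) (lt_ab : (alpha%:E < beta)%E)
    (PrimP : antiderivative_choice n alpha beta Prim) :
  (forall (F : R -> R) (C : R), admissible n alpha beta Prim F C ->
     exists g : 'rV[R]_(n + n) -> 'M[R]_(n + n),
       [/\ Un_nonkahler_klsc (annulus alpha beta) g,
           forall p, annulus alpha beta p -> g p = g_pair Prim F C p
         & forall g' : 'rV[R]_(n + n) -> 'M[R]_(n + n),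
             Un_nonkahler_klsc (annulus alpha beta) g' ->
             (forall p, annulus alpha beta p -> g' p = g_pair Prim F C p) ->
             forall p, annulus alpha beta p -> g' p = g p]) /\
  (forall g : 'rV[R]_(n + n) -> 'M[R]_(n + n),
     Un_nonkahler_klsc (annulus alpha beta) g <->
     exists (F : R -> R) (C : R),
       admissible n alpha beta Prim F C /\
       forall p, annulus alpha beta p -> g p = g_pair Prim F C p).
Proof.
split=> [F C adm|g].
  exists (g_pair Prim F C); split=> [||g' _ g'E p Up] //; last exact: g'E.
  exact: (admissible_klsc n_ge2 alpha_ge0 lt_ab PrimP adm).
split; first exact: klsc_admissible.
by case=> F [C [adm gE]]; exact: (admissible_klsc n_ge2 alpha_ge0 lt_ab PrimP adm gE).
Qed.
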